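(* Let $\Omega\subset\mathbb{R}^n$ be a bounded domain and let $G$ be an N-function with $g=G'$ such that, for some constants $p^\pm$, $1<p^-\le \frac{t g(t)}{G(t)}\le p^+<\infty$ for all $t>0$. Let $r>0$ and let $u_r$ be a solution of the minimization problem $$c_r:=\inf\left\{\int_\Omega G(\Delta u)\,dx:\ u\in W^{2,G}_0(\Omega),\ \int_\Omega G(u)\,dx=r\right\},$$ that is, $u_r\in W^{2,G}_0(\Omega)$, $\int_\Omega G(u_r)\,dx=r$ and $\int_\Omega G(\Delta u_r)\,dx=c_r$. Then there is $\lambda_r>0$ such that $$\Delta_g^2u_r=\lambda_r\frac{g(|u_r|)}{|u_r|}u_r\quad\text{weakly in }\Omega,$$ that is, $$\int_\Omega \frac{g(|\Delta u_r|)}{|\Delta u_r|}\Delta u_r\,\Delta v\,dx=\lambda_r\int_\Omega\frac{g(|u_r|)}{|u_r|}u_r\,v\,dx\quad\text{for all }v\in W^{2,G}_0(\Omega).$$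
   Context: An N-function is an even function $G:\mathbb{R}\to[0,\infty)$ of the form $G(t)=\int_0^t g(s)\,ds$, where $g$ is odd, continuous, non-decreasing, $g(0)=0$, $g(t)>0$ for $t>0$, and $g(t)\to\infty$ as $t\to\infty$. The biharmonic $g$-Laplacian is formally $\Delta_g^2u=\Delta\left(\frac{g(|\Delta u|)}{|\Delta u|}\Delta u\right)$; expressions $\frac{g(|w|)}{|w|}w$ are understood as $0$ where $w=0$. $L^G(\Omega)$ is the space of measurable $u:\Omega\to\mathbb{R}$ with $\int_\Omega G(u)\,dx<\infty$, with the Luxemburg norm $\|u\|_G=\inf\{\lambda>0:\int_\Omega G(u/\lambda)\,dx\le 1\}$. $W^{2,G}(\Omega)$ is the space of $u$ whose distributional derivatives $D^\alpha u$, $|\alpha|\le 2$, all lie in $L^G(\Omega)$, with norm $\sum_{|\alpha|\le 2}\|D^\alpha u\|_G$, and $W^{2,G}_0(\Omega)$ is the closure of $C_0^\infty(\Omega)$ in it, equipped with the (equivalent) norm $\|u\|_{2,G}:=\|\Delta u\|_G$. Standing assumptions on $G$: $\int_0^1 \frac{G^{-1}(s)}{s^{(n+1)/n}}ds<\infty$ and $\int_1^\infty \frac{G^{-1}(s)}{s^{(n+1)/n}}ds=\infty$. *)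

(* Defs.v *)
From HB Require Import structures.
From mathcomp Require Import all_boot all_order all_algebra.
From mathcomp Require Import all_classical all_reals all_analysis.
Set Implicit Arguments.
Unset Strict Implicit.
Unset Printing Implicit Defensive.
Import Order.TTheory GRing.Theory Num.Theory.
Import numFieldNormedType.Exports.
Local Open Scope classical_set_scope.
Local Open Scope ring_scope.

Definition rV_display : measure_display.
Proof. exact: default_measure_display. Qed.

(* The sigma-algebra on R^n generated by the coordinate projections, which is
   the Borel sigma-algebra. *)
Section measurable_rV.
Variables (R : realType) (n : nat).

Definition rV_coord (i : 'I_n) (x : 'rV[R]_n) : measurableTypeR R := x ord0 i.

Let rV_set0 : g_sigma_preimage rV_coord set0.
Proof. exact: sigma_algebra0. Qed.

Let rV_setC A : g_sigma_preimage rV_coord A -> g_sigma_preimage rV_coord (~` A).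
Proof. exact: sigma_algebraC. Qed.

Let rV_bigcup (F : (set 'rV[R]_n)^nat) :
  (forall i, g_sigma_preimage rV_coord (F i)) ->
  g_sigma_preimage rV_coord (\bigcup_i (F i)).
Proof. exact: sigma_algebra_bigcup. Qed.

HB.instance Definition _ := @isMeasurable.Build rV_display 'rV[R]_n
  (g_sigma_preimage rV_coord) rV_set0 rV_setC rV_bigcup.

Lemma measurable_rV_coord (i : 'I_n) : measurable_fun setT (rV_coord i).
Proof.
move=> _ Y mY; rewrite setTI; apply: sub_sigma_algebra => /=.
rewrite -bigcup_seq/=; exists i => /=; first by rewrite mem_index_enum.
by exists Y => //; rewrite setTI.
Qed.

Lemma measurable_fun_rVP d (T : measurableType d) (f : T -> 'rV[R]_n) :
  (forall i, measurable_fun setT (rV_coord i \o f)) -> measurable_fun setT f.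
Proof.
move=> mf; suff : g_sigma_preimage (fun i => rV_coord i \o f) `<=` measurable.
  by rewrite g_sigma_preimage_comp => sm _ A mA; apply: sm; exists A.
apply: smallest_sub; first exact: sigma_algebra_measurable.
move=> B; rewrite -bigcup_seq => -[i _ [A mA <-]].
exact: mf.
Qed.

End measurable_rV.

Section lebesgue_rV.
Variable R : realType.

Definition rV_cons n (p : measurableTypeR R * 'rV[R]_n) : 'rV[R]_n.+1 :=
  row_mx (const_mx p.1 : 'rV[R]_1) p.2.

Definition rV_uncons n (x : 'rV[R]_n.+1) : measurableTypeR R * 'rV[R]_n :=
  (x ord0 ord0, \row_i x ord0 (lift ord0 i)).

Lemma rV_consE0 n p : @rV_cons n p ord0 ord0 = p.1.
Proof.
rewrite /rV_cons (_ : ord0 = lshift n (ord0 : 'I_1)); last exact: val_inj.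
by rewrite [LHS]row_mxEl mxE.
Qed.

Lemma rV_consES n p i : @rV_cons n p ord0 (lift ord0 i) = p.2 ord0 i.
Proof.
rewrite /rV_cons (_ : lift ord0 i = rshift 1 i); last exact: val_inj.
by rewrite [LHS]row_mxEr.
Qed.

Lemma rV_consK n : cancel (@rV_cons n) (@rV_uncons n).
Proof.
move=> [a x]; rewrite /rV_uncons rV_consE0; congr pair.
by apply/rowP => i; rewrite mxE rV_consES.
Qed.

Lemma measurable_rV_cons n : measurable_fun setT (@rV_cons n).
Proof.
apply: measurable_fun_rVP => i; have [j ->|->] := unliftP ord0 i.
- rewrite (_ : _ \o _ = rV_coord j \o snd); last first.
    by apply/funext => p /=; rewrite /rV_coord rV_consES.
  by apply: measurableT_comp => //; exact: measurable_rV_coord.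
- rewrite (_ : _ \o _ = fst) //.
  by apply/funext => p /=; rewrite /rV_coord rV_consE0.
Qed.

Lemma measurable_rV_uncons n : measurable_fun setT (@rV_uncons n).
Proof.
apply/measurable_fun_pairP; split; first exact: measurable_rV_coord.
apply: measurable_fun_rVP => i.
rewrite (_ : _ \o _ = rV_coord (lift ord0 i)); first exact: measurable_rV_coord.
by apply/funext => x; rewrite /rV_coord /= mxE.
Qed.

Section step.
Local Open Scope ereal_scope.
Variables (n : nat) (mu : {sigma_finite_measure set 'rV[R]_n -> \bar R}).

Definition lebesgue_rV_step : set 'rV[R]_n.+1 -> \bar R :=
  pushforward (@lebesgue_measure R \x mu) (@rV_cons n).

Let step0 : lebesgue_rV_step set0 = 0.
Proof. by rewrite /lebesgue_rV_step /pushforward preimage_set0 measure0. Qed.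

Let step_ge0 A : 0 <= lebesgue_rV_step A.
Proof. by rewrite /lebesgue_rV_step /pushforward measure_ge0. Qed.

Let step_sigma_additive : semi_sigma_additive lebesgue_rV_step.
Proof.
move=> F mF tF mUF; rewrite /lebesgue_rV_step /pushforward preimage_bigcup.
apply: measure_semi_sigma_additive.
- move=> k; rewrite -[X in measurable X]setTI; exact: measurable_rV_cons.
- apply/trivIsetP => /= i j _ _ ij; rewrite -preimage_setI.
  by move/trivIsetP : tF => /(_ _ _ _ _ ij) ->//; rewrite preimage_set0.
- rewrite -preimage_bigcup -[X in measurable X]setTI.
  exact: measurable_rV_cons.
Qed.

HB.instance Definition _ := isMeasure.Build _ _ _
  lebesgue_rV_step step0 step_ge0 step_sigma_additive.

Let step_sigma_finite : sigma_finite setT lebesgue_rV_step.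
Proof.
have [F FT Ffin] : sigma_finite setT (@lebesgue_measure R \x mu).
  have /sigma_finiteP[F [TF ndF Foo]] := sigma_finiteT (@lebesgue_measure R).
  have /sigma_finiteP[H [TH ndH Hoo]] := sigma_finiteT mu.
  exists (fun k => F k `*` H k).
    rewrite -setXTT TF TH predeqE => -[x y]; split.
      move=> [/= [k _ Fkx] [l _ Hly]]; exists (maxn k l) => //; split.
      - by move: x Fkx; exact/subsetPset/ndF/leq_maxl.
      - by move: y Hly; exact/subsetPset/ndH/leq_maxr.
    by move=> [k _ []/= ? ?]; split; exists k.
  move=> k; have [? ?] := Foo k; have [? ?] := Hoo k.
  split; first exact: measurableX.
  by rewrite product_measure1E// lte_mul_pinfty// ge0_fin_numE.
exists (fun k => @rV_uncons n @^-1` F k).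
  by rewrite -preimage_bigcup -FT preimage_setT.
move=> k; have [mF Foo] := Ffin k; split.
  by rewrite -[X in measurable X]setTI; exact: measurable_rV_uncons.
rewrite /lebesgue_rV_step /pushforward (_ : _ @^-1` _ = F k)//.
by apply/seteqP; split => x /=; rewrite rV_consK.
Qed.

HB.instance Definition _ := @Measure_isSigmaFinite.Build _ _ _
  lebesgue_rV_step step_sigma_finite.

End step.

(* n-dimensional Lebesgue measure, as the iterated product of the
   one-dimensional one; R^0 carries the unit mass. *)
Fixpoint lebesgue_rV (n : nat) : {sigma_finite_measure set 'rV[R]_n -> \bar R} :=
  match n with
  | 0 => dirac (0 : 'rV[R]_0)
  | n'.+1 => lebesgue_rV_step (lebesgue_rV n')
  end.

Lemma lebesgue_rV_box n (a b : 'rV[R]_n) :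
  (forall i, a ord0 i <= b ord0 i) ->
  lebesgue_rV n [set x : 'rV[R]_n | forall i, x ord0 i \in `[a ord0 i, b ord0 i]]
  = (\prod_(i < n) (b ord0 i - a ord0 i))%:E.
Proof.
elim: n a b => [|n IH] a b ab /=.
  by rewrite big_ord0 diracE mem_set//= => -[].
pose tl (x : 'rV[R]_n.+1) : 'rV[R]_n := \row_i x ord0 (lift ord0 i).
rewrite /lebesgue_rV_step /pushforward.
set B := [set x : 'rV[R]_n | forall i, x ord0 i \in `[tl a ord0 i, tl b ord0 i]].
rewrite (_ : _ @^-1` _ = `[a ord0 ord0, b ord0 ord0]%classic `*` B); last first.
  apply/seteqP; split => -[x y] /=.
    move=> h; split; first by have := h ord0; rewrite rV_consE0.
    by move=> i; have := h (lift ord0 i); rewrite rV_consES !mxE.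
  move=> [h1 h2] i; have [j ->|->] := unliftP ord0 i; last by rewrite rV_consE0.
  by have := h2 j; rewrite rV_consES !mxE.
have mB : measurable B.
  rewrite (_ : B = \bigcap_(i in [set: 'I_n])
      (rV_coord i @^-1` `[tl a ord0 i, tl b ord0 i]%classic)); last first.
    by apply/seteqP; split => [x h i _|x h i]; [exact: h|exact: (h i I)].
  apply: fin_bigcap_measurable => [|i _]; first exact: finite_finset.
  rewrite -[X in measurable X]setTI; exact: measurable_rV_coord.
rewrite product_measure1E//=.
rewrite lebesgue_measure_itv/= lte_fin big_ord_recl IH; last first.
  by move=> i; rewrite !mxE.
rewrite [X in (_ * X)%E](_ : _ =
  (\prod_(i < n) (b ord0 (lift ord0 i) - a ord0 (lift ord0 i)))%:E); last first.
  by congr EFin; apply: eq_bigr => i _; rewrite !mxE.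
have := ab ord0; rewrite le_eqVlt => /predU1P[->|abi].
  by rewrite ltxx subrr mul0e mul0r.
by rewrite abi -EFinB -EFinM.
Qed.

End lebesgue_rV.

Section calculus.
Variables (R : realType) (n : nat).
Implicit Types (f u w : 'rV[R]_n -> R) (Om : set 'rV[R]_n).

Definition partial (i : 'I_n) f : 'rV[R]_n -> R :=
  fun x => 'D_(delta_mx ord0 i) f x.

Definition smooth f := forall s : seq 'I_n,
  continuous (foldr partial f s) /\
  forall i x, derivable (foldr partial f s) x (delta_mx ord0 i).

Definition test_function Om f :=
  [/\ smooth f, compact (closure [set x | f x != 0]) &
      closure [set x | f x != 0] `<=` Om].

(* D^a for a multi-index a *)
Definition multiD (a : 'I_n -> nat) f : 'rV[R]_n -> R :=
  foldr (fun i h => iter (a i) (partial i) h) f (enum 'I_n).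

Definition loc_integrable Om u :=
  measurable_fun Om u /\
  forall K, compact K -> K `<=` Om -> (lebesgue_rV R n).-integrable K (EFin \o u).

Definition is_weakD Om (a : 'I_n -> nat) u w :=
  [/\ loc_integrable Om u, loc_integrable Om w &
    forall phi, test_function Om phi ->
      \int[lebesgue_rV R n]_(x in Om) (u x * multiD a phi x) =
      (-1) ^+ (\sum_i a i)%N * \int[lebesgue_rV R n]_(x in Om) (w x * phi x)].

(* The weak derivative is determined up to equality almost everywhere on Om;
   this picks a representative (when there is one). *)
Definition weakD Om (a : 'I_n -> nat) u : 'rV[R]_n -> R :=
  get [set w | is_weakD Om a u w].

Definition laplacian Om u : 'rV[R]_n -> R := fun x =>
  \sum_(i < n) weakD Om (fun j => if j == i then 2%N else 0%N) u x.

End calculus.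

(* G is an N-function with density g; the integral formula for t >= 0
   determines G on the whole line by evenness. *)
Record Nfunction (R : realType) (g G : R -> R) : Prop := {
  Nfun_g_odd : forall t, g (- t) = - g t ;
  Nfun_g_continuous : continuous g ;
  Nfun_g_nondecreasing : {homo g : s t / s <= t} ;
  Nfun_g0 : g 0 = 0 ;
  Nfun_g_gt0 : forall t, 0 < t -> 0 < g t ;
  Nfun_g_infty : g t @[t --> +oo] --> +oo ;
  Nfun_G_even : forall t, G (- t) = G t ;
  Nfun_G_integral : forall t, 0 <= t ->
    G t = \int[lebesgue_measure]_(s in `[0, t]) g s
}.

(* the inverse of the restriction of G to [0, +oo) *)
Definition Ninv (R : realType) (G : R -> R) (s : R) : R :=
  get [set t | 0 <= t /\ G t = s].

Section Orlicz_Sobolev.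
Local Open Scope ereal_scope.
Variables (R : realType) (n : nat) (G : R -> R) (Om : set 'rV[R]_n).
Implicit Types u : 'rV[R]_n -> R.

Definition modular u : \bar R := \int[lebesgue_rV R n]_(x in Om) (G (u x))%:E.

Definition orlicz : set ('rV[R]_n -> R) :=
  [set u | measurable_fun Om u /\ modular u < +oo].

Definition luxemburg u : \bar R :=
  ereal_inf [set l%:E | l in
    [set l : R | (0 < l)%R /\ modular (fun x => u x / l)%R <= 1]].

Definition W2G : set ('rV[R]_n -> R) :=
  [set u | forall a : 'I_n -> nat, (\sum_i a i <= 2)%N ->
     exists2 w, orlicz w & is_weakD Om a u w].

(* Multi-indices of length at most 2 have entries at most 2, hence the type. *)
Definition W2G_norm u : \bar R :=
  \sum_(a : {ffun 'I_n -> 'I_3} | (\sum_i a i <= 2)%N)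
    luxemburg (weakD Om (fun i => a i) u).

Definition W2G0 : set ('rV[R]_n -> R) :=
  [set u | W2G u /\ forall e : R, (0 < e)%R ->
     exists2 phi, test_function Om phi & W2G_norm (u \- phi)%R < e%:E].

Definition min_energy (r : R) : \bar R :=
  ereal_inf [set modular (laplacian Om u) | u in
    [set u | W2G0 u /\ modular u = r%:E]].

End Orlicz_Sobolev.

(* Main.v *)
Require Import Defs.
From HB Require Import structures.
From mathcomp Require Import all_boot all_order all_algebra.
From mathcomp Require Import all_classical all_reals all_analysis.
From mathcomp Require Import measurable_realfun ring lra.
Set Implicit Arguments.
Unset Strict Implicit.
Unset Printing Implicit Defensive.
Import Order.TTheory GRing.Theory Num.Theory.
Import numFieldNormedType.Exports.
Local Open Scope classical_set_scope.
Local Open Scope ring_scope.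

(** The functional J(v), the integral of G(v) over Om, is the constraint, and
    K(v), the integral of G(Laplacian v), is the energy; their derivatives at the
    minimizer u in the direction v are b(v), the integral of g(u) v, and a(v), the
    integral of g(Laplacian u) (Laplacian v).  The multiplier must be a(u) / b(u),
    and since b(u) >= J(u) = r > 0 it suffices to show that a(w) = 0 whenever
    b(w) = 0: apply this to w = v - (b(v) / b(u)) u.

    The implicit function theorem is replaced by convexity.  If b(w) = 0, then
    J(u + t w) >= J(u) + t b(w) = r for every t, so some s in [0, 1] satisfies
    J(s (u + t w)) = r, and minimality gives
    K(u) <= K(s (u + t w)) <= K(u + t w).
    Hence t |-> K(u + t w) is minimal at t = 0 and a(w) = 0
    (minimizer_tangential, energy_min_variation, minimizer_Euler_Lagrange).  The
    growth condition t g(t) <= p^+ G(t) enters through the Delta_2 condition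
    (Nfun_Delta2), which makes L^G a vector space and the pairings finite.

    The multiplier is positive because a(u) >= K(u), and K(u) = 0 would make u
    harmonic.  A function of W^{2,G}_0 is a limit of test functions, so its
    Laplacian can be integrated by parts against exponentials exp(xi . x)
    (W2G0_ibp), and a harmonic one is orthogonal to all of them with xi <> 0.
    Explicit polynomials in exponentials converge boundedly to the indicators of
    orthants, which forces u = 0 (W2G0_harmonic_eq0), against J(u) = r > 0.

    What remains is that the Laplacian is linear almost everywhere and that
    W^{2,G}_0 is a vector space although weak derivatives are chosen
    representatives.  Both rest on the uniqueness of weak derivatives
    (is_weakD_unique), hence on the fundamental lemma of the calculus of
    variations, whose test functions are products of the bumps exp(-1/t), and on
    the fact that test functions have their classical derivatives as weak ones
    (is_weakD_test), which is Fubini and the fundamental theorem of calculus in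
    each coordinate (integral_partial_eq0). *)

Lemma le_Bernoulli (R : realDomainType) (x : R) k :
  -1 <= x -> 1 + k%:R * x <= (1 + x) ^+ k.
Proof.
move=> x1; elim: k => [|k IH]; first by rewrite mul0r addr0 expr0.
rewrite exprS; apply: (@le_trans _ _ ((1 + x) * (1 + k%:R * x))).
  have : 0 <= k%:R * (x * x) by rewrite mulr_ge0// -expr2 sqr_ge0.
  by rewrite -natr1; lra.
by rewrite ler_wpM2l// -lerBlDl sub0r.
Qed.

(** * N-functions *)

Section Nfunction_theory.
Variables (R : realType) (g G : R -> R).
Hypothesis NG : Nfunction g G.

Let g_int (a b : R) : lebesgue_measure.-integrable `[a, b] (EFin \o g).
Proof.
apply: continuous_compact_integrable; first exact: segment_compact.
by apply: continuous_subspaceT; exact: Nfun_g_continuous NG.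
Qed.

Lemma NfunG0 : G 0 = 0.
Proof. by rewrite (Nfun_G_integral NG)// set_itv1 Rintegral_set1. Qed.

(* On [0, +oo) the increment of G over [a, b] is an integral of the monotone
   function g, hence lies between the values at the endpoints times b - a. *)
Let G_incr (a b : R) : 0 <= a -> a <= b ->
  g a * (b - a) <= G b - G a <= g b * (b - a).
Proof.
move=> a0 ab.
have -> : G b - G a = \int[lebesgue_measure]_(s in `]a, b]) g s.
  rewrite (Nfun_G_integral NG (le_trans a0 ab)) (Nfun_G_integral NG a0).
  by rewrite Rintegral_itvB ?bnd_simp.
have mE : measurable `]a, b]%classic by [].
have ig : lebesgue_measure.-integrable `]a, b] (EFin \o g).
  by apply: integrableS (g_int a b) => //; exact: subset_itv_oc_cc.
have ic c : lebesgue_measure.-integrable `]a, b] (EFin \o cst (c : R)).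
  apply: (@integrableS _ _ _ lebesgue_measure `[a, b]%classic) => //.
    exact: subset_itv_oc_cc.
  apply: continuous_compact_integrable; first exact: segment_compact.
  by apply: continuous_subspaceT => x; exact: cvg_cst.
have E c : c * (b - a) = \int[lebesgue_measure]_(s in `]a, b]) cst c s.
  rewrite Rintegral_cst//= lebesgue_measure_itv/= lte_fin.
  move: ab; rewrite le_eqVlt => /predU1P[->|->//].
  by rewrite subrr mulr0 ltxx mulr0.
rewrite !E; apply/andP; split; apply: le_Rintegral => // x /=;
  rewrite in_itv/= => /andP[ax xb]; apply: (Nfun_g_nondecreasing NG) => //.
exact: ltW.
Qed.

Lemma Nfun_g_ge0 t : 0 <= t -> 0 <= g t.
Proof. by move=> t0; rewrite -(Nfun_g0 NG); exact: Nfun_g_nondecreasing NG _ _ t0. Qed.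

Lemma Nfun_g_norm t : `|g t| = g `|t|.
Proof.
have [t0|t0] := leP 0 t; first by rewrite ger0_norm ?Nfun_g_ge0// ger0_norm.
rewrite (ltr0_norm t0) (Nfun_g_odd NG) -normrN -(Nfun_g_odd NG).
by rewrite (Nfun_g_odd NG) ger0_norm // -(Nfun_g_odd NG) Nfun_g_ge0// oppr_ge0 ltW.
Qed.

Lemma Nfun_G_norm t : G `|t| = G t.
Proof.
have [//|t0] := leP 0 t; first by move=> t0; rewrite ger0_norm.
by rewrite (ltr0_norm t0) (Nfun_G_even NG).
Qed.

(** G is convex with slope g: this tangent inequality replaces every use of
    the differentiability of G. *)
Lemma Nfun_tangent a b : g a * (b - a) <= G b - G a.
Proof.
wlog a0 : a b / 0 <= a.
  move=> H; have [a0|a0] := leP 0 a; first exact: H.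
  have := H (- a) (- b); rewrite oppr_ge0 (ltW a0) (Nfun_g_odd NG) => /(_ isT).
  rewrite !(Nfun_G_even NG) => h; apply: le_trans h; rewrite le_eqVlt.
  by apply/orP; left; apply/eqP; ring.
have [b0|b0] := leP 0 b.
  have [ab|ba] := leP a b; first by have /andP[] := G_incr a0 ab.
  by have /andP[_] := G_incr b0 (ltW ba); lra.
have nb0 : 0 <= - b by rewrite oppr_ge0 ltW.
have ga0 := Nfun_g_ge0 a0.
have [ab|ba] := leP a (- b).
  have /andP[+ _] := G_incr a0 ab; rewrite (Nfun_G_even NG); nra.
have /andP[_] := G_incr nb0 (ltW ba); rewrite (Nfun_G_even NG); nra.
Qed.

Lemma Nfun_G_ge0 t : 0 <= G t.
Proof. by have := Nfun_tangent 0 t; rewrite (Nfun_g0 NG) NfunG0; lra. Qed.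

Lemma Nfun_G_le s t : `|s| <= `|t| -> G s <= G t.
Proof.
move=> st; rewrite -(Nfun_G_norm s) -(Nfun_G_norm t).
by have := Nfun_tangent `|s| `|t|; have := Nfun_g_ge0 (normr_ge0 s); nra.
Qed.

Lemma Nfun_G_gt0 t : t != 0 -> 0 < G t.
Proof.
move=> t0; have t2 : 0 < `|t| / 2 by rewrite divr_gt0 ?normr_gt0.
have := Nfun_tangent (`|t| / 2) `|t|; rewrite (Nfun_G_norm t).
have := Nfun_g_gt0 NG t2; have := Nfun_G_ge0 (`|t| / 2); nra.
Qed.

Lemma Nfun_G_convex (l a b : R) : 0 <= l <= 1 ->
  G (l * a + (1 - l) * b) <= l * G a + (1 - l) * G b.
Proof.
move=> /andP[l0 l1]; set c := l * a + (1 - l) * b.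
have := Nfun_tangent c a; have := Nfun_tangent c b.
suff : g c * (l * a + (1 - l) * b - c) = 0 by nra.
by rewrite subrr mulr0.
Qed.

(** On a bounded neighbourhood the tangent inequality in both directions makes G
    Lipschitz. *)
Lemma Nfun_G_continuous : continuous G.
Proof.
move=> x; apply/cvgrPdist_le => /= e e0.
set M := g (`|x| + 1) + 1.
have gx0 : 0 <= g (`|x| + 1) by apply: Nfun_g_ge0; rewrite addr_ge0.
have M0 : 0 < M by rewrite ltr_wpDl.
near=> y.
have xy1 : `|x - y| <= 1 by near: y; apply: cvgr_dist_le => //; exact: cvg_id.
have xye : `|x - y| <= e / M.
  by near: y; apply: cvgr_dist_le; [exact: cvg_id|rewrite divr_gt0].
have gM z : `|z| <= `|x| + 1 -> `|g z| <= M.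
  move=> zx; rewrite Nfun_g_norm; apply: (@le_trans _ _ (g (`|x| + 1))).
    exact: Nfun_g_nondecreasing NG _ _ zx.
  by rewrite lerDl.
have gx : `|g x| <= M by apply: gM; rewrite lerDl.
have gy : `|g y| <= M.
  by apply: gM; rewrite -[y](subrK x) addrC (le_trans (ler_normD _ _))// lerD2l distrC.
have Mxy : M * `|x - y| <= e by rewrite mulrC -ler_pdivlMr.
rewrite ler_distl; have := Nfun_tangent x y; have := Nfun_tangent y x.
have h1 : `|g x * (y - x)| <= e.
  by rewrite normrM distrC (le_trans _ Mxy)// ler_wpM2r.
have h2 : `|g y * (x - y)| <= e by rewrite normrM (le_trans _ Mxy)// ler_wpM2r.
move: h1 h2; rewrite !ler_norml; lra.
Unshelve. all: by end_near. Qed.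

(** An upper bound t g(t) <= p G(t) yields the Delta_2 condition: a step from t
    to t (1 + 1/(2p)) at most doubles G, and finitely many steps reach 2t. *)
Lemma Nfun_Delta2 (p : R) : 0 < p -> (forall t, 0 < t -> t * g t <= p * G t) ->
  exists2 C, 0 < C & forall t, G (2 * t) <= C * G t.
Proof.
move=> p0 gG.
pose q := 1 + (2 * p)^-1.
have q1 : 1 < q by rewrite ltrDl invr_gt0 mulr_gt0.
have q0 : 0 < q by rewrite (lt_trans _ q1).
have step t : 0 <= t -> G (q * t) <= 2 * G t.
  rewrite le_eqVlt => /predU1P[<-|t0]; first by rewrite !mulr0 NfunG0 mulr0.
  have := Nfun_tangent (q * t) t.
  have := gG (q * t) (mulr_gt0 q0 t0); set Gq := G (q * t); set gq := g (q * t).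
  have gq0 : 0 <= gq by rewrite Nfun_g_ge0// mulr_ge0// ltW.
  have -> : gq * (t - q * t) = - ((2 * p)^-1 * (t * gq)) by rewrite /q; ring.
  move=> h1 h2.
  have h3 : t * gq <= p * Gq by apply: le_trans h1; rewrite ler_wpM2r// ler_peMl ?ltW.
  have : (2 * p)^-1 * (t * gq) <= (2 * p)^-1 * (p * Gq).
    by rewrite ler_wpM2l// invr_ge0 mulr_ge0// ltW.
  have -> : (2 * p)^-1 * (p * Gq) = Gq / 2 by field; rewrite gt_eqF.
  lra.
have steps k t : 0 <= t -> G (q ^+ k * t) <= 2 ^+ k * G t.
  move=> t0; elim: k => [|k IH]; first by rewrite !expr0 !mul1r.
  rewrite !exprS -!mulrA; apply: le_trans (step _ _) _.
    by rewrite mulr_ge0// exprn_ge0// ltW.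
  by rewrite ler_wpM2l.
(* a power of 1 + 1/(2p) exceeds 2, by Bernoulli's inequality *)
have [k qk] : exists k, 2 <= q ^+ k.
  exists (Num.bound (2 * p)).
  have p2 : 0 < 2 * p by rewrite mulr_gt0.
  apply: le_trans (le_Bernoulli _ _); last first.
    by apply: (@le_trans _ _ 0) => //; rewrite invr_ge0 ltW.
  have -> : 2 = 1 + 1 :> R by lra.
  rewrite lerD2l ler_pdivlMr// mul1r ltW//.
  by have := archi_boundP (ltW p2).
exists (2 ^+ k); first by rewrite exprn_gt0.
move=> t; rewrite -(Nfun_G_norm t); apply: le_trans (steps k _ (normr_ge0 t)).
apply: Nfun_G_le; rewrite !normrM normr_id ler_wpM2r// !ger0_norm// exprn_ge0// ltW//.
Qed.

End Nfunction_theory.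

(** * Smooth functions on R^n *)

Lemma is_derive_lineP (R : realType) (V : normedModType R) (f : V -> R) x v d :
  is_derive x v f d <-> is_derive (0 : R) 1 (fun h : R => f (h *: v + x)) d.
Proof.
have E : 'D_v f x = 'D_1 (fun h : R => f (h *: v + x)) 0.
  rewrite /derive; set d1 := fun h => h^-1 *: _; set d2 := fun h => h^-1 *: _.
  suff -> : d1 = d2 by [].
  by apply/funext => h; rewrite /d1 /d2 /= addr0 scale0r add0r [_%:A]mulr1.
split=> -[df dE]; split.
- exact: (derivable1P f x v).1.
- by rewrite -E.
- exact: (derivable1P f x v).2.
- by rewrite E.
Qed.

(** Reduces the directional derivatives of a function of one linear form to a
    derivative in one variable. *)
Lemma is_derive_comp_affine (R : realType) (V : normedModType R) (h : R -> R)
    (L : V -> R) (x v : V) (c d : R) :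
  (forall t, L (t *: v + x) = L x + t * c) ->
  is_derive (L x) 1 h d -> is_derive x v (h \o L) (c * d).
Proof.
move=> LE hd; apply/is_derive_lineP.
have -> : (fun t : R => (h \o L) (t *: v + x)) = h \o (fun t : R => L x + t * c).
  by apply/funext => t /=; rewrite LE.
have aff : is_derive (0 : R) 1 (fun t : R => L x + t * c) c.
  have -> : (fun t : R => L x + t * c) = horner ((L x)%:P + c *: 'X).
    by apply/funext => t; rewrite !hornerE mulrC.
  apply: is_derive_eq (is_derive_poly _ _) _.
  by rewrite derivD derivC derivZ derivX !hornerE.
rewrite mulrC; apply: is_derive1_comp => //.
by rewrite mul0r addr0.
Qed.

Section Ck_functions.
Variables (R : realType) (n : nat).
Implicit Types (f g : 'rV[R]_n -> R) (k : nat).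

Definition partials f := forall i x, derivable f x (delta_mx ord0 i).

Lemma is_derive_partial f i x : partials f ->
  is_derive x (delta_mx ord0 i) f (partial i f x).
Proof. by move=> df; exact/derivableP. Qed.

(** Smoothness measured by the order of differentiability, which is the form
    that the Leibniz rule propagates by induction. *)
Fixpoint Ck k f : Prop :=
  if k is k'.+1 then [/\ continuous f, partials f & forall i, Ck k' (partial i f)]
  else continuous f.

Lemma Ck_continuous k f : Ck k f -> continuous f.
Proof. by case: k => [//|k] []. Qed.

Lemma CkS k f : Ck k.+1 f -> Ck k f.
Proof.
elim: k f => [f []//|k IH f [cf df pf]]; split => // i.
exact: IH.
Qed.

Lemma smooth_partial f i : smooth f -> smooth (partial i f).
Proof. by move=> sf s; have := sf (rcons s i); rewrite foldr_rcons. Qed.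

Lemma smooth_continuous f : smooth f -> continuous f.
Proof. by move=> /(_ [::])[]. Qed.

Lemma smooth_partials f : smooth f -> partials f.
Proof. by move=> /(_ [::])[]. Qed.

(* Peeling the innermost derivative off the list matches the recursion of Ck. *)
Lemma smoothP f : smooth f <-> forall k, Ck k f.
Proof.
split=> [sf k|Cf s].
  elim: k f sf => [|k IH] f sf /=; first exact: smooth_continuous.
  split; [exact: smooth_continuous|exact: smooth_partials|].
  by move=> i; apply: IH; exact: smooth_partial.
have : Ck (size s).+1 f by [].
elim/last_ind: s f {Cf} => [|s i IH] f; first by case.
by rewrite size_rcons foldr_rcons => -[_ _ /(_ i)]; exact: IH.
Qed.

Lemma partialD f g i : partials f -> partials g ->
  partial i (fun x => f x + g x) = (fun x => partial i f x + partial i g x).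
Proof. by move=> df dg; apply/funext => x; rewrite /partial deriveD. Qed.

Lemma partialM f g i : partials f -> partials g ->
  partial i (fun x => f x * g x) =
  (fun x => partial i f x * g x + f x * partial i g x).
Proof.
move=> df dg; apply/funext => x; rewrite /partial deriveM//.
by rewrite addrC [X in X + _ = _]mulrC.
Qed.

Lemma partial_cst (c : R) (i : 'I_n) :
  partial i (fun _ : 'rV[R]_n => c) = (fun=> 0).
Proof. by apply/funext => x; rewrite /partial derive_cst. Qed.

Lemma Ck_cst k (c : R) : Ck k (fun _ : 'rV[R]_n => c).
Proof.
elim: k c => [|k IH] c /=; first exact: cst_continuous.
split=> [|i x|i]; [exact: cst_continuous|by case: (is_derive_cst c x (delta_mx ord0 i))|].
by rewrite partial_cst.
Qed.

Lemma CkD k f g : Ck k f -> Ck k g -> Ck k (fun x => f x + g x).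
Proof.
elim: k f g => [|k IH] f g /=; first by move=> cf cg x; exact: cvgD (cf x) (cg x).
move=> [cf df pf] [cg dg pg]; split=> [x|i x|i].
- exact: cvgD (cf x) (cg x).
- exact: derivableD.
- by rewrite partialD//; apply: IH.
Qed.

Lemma CkM k f g : Ck k f -> Ck k g -> Ck k (fun x => f x * g x).
Proof.
elim: k f g => [|k IH] f g.
  by move=> /= cf cg x; exact: cvgM (cf x) (cg x).
move=> Cf Cg; have := Cf; have := Cg => -[cg dg pg] [cf df pf]; split=> [x|i x|i].
- exact: cvgM (cf x) (cg x).
- exact: derivableM.
- rewrite partialM//; apply: CkD; apply: IH;
    by [exact: pf|exact: pg|exact: CkS Cf|exact: CkS Cg].
Qed.

Lemma smooth_cst (c : R) : smooth (fun _ : 'rV[R]_n => c).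
Proof. by apply/smoothP => k; exact: Ck_cst. Qed.

Lemma smoothD f g : smooth f -> smooth g -> smooth (fun x => f x + g x).
Proof. by move=> /smoothP sf /smoothP sg; apply/smoothP => k; exact: CkD. Qed.

Lemma smoothM f g : smooth f -> smooth g -> smooth (fun x => f x * g x).
Proof. by move=> /smoothP sf /smoothP sg; apply/smoothP => k; exact: CkM. Qed.

Lemma smooth_prod (I : Type) (s : seq I) (F : I -> 'rV[R]_n -> R) :
  (forall i, smooth (F i)) -> smooth (fun x => \prod_(i <- s) F i x).
Proof.
move=> sF; elim: s => [|i s IH].
  rewrite (_ : (fun x => _) = fun=> 1); first exact: smooth_cst.
  by apply/funext => x; rewrite big_nil.
rewrite (_ : (fun x => _) = fun x => F i x * \prod_(j <- s) F j x).
  exact: smoothM (sF i) IH.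
by apply/funext => x; rewrite big_cons.
Qed.

Lemma partial_lin f g (t : R) i : smooth f -> smooth g ->
  partial i (fun x => f x + t * g x) =
  (fun x => partial i f x + t * partial i g x).
Proof.
move=> sf sg; rewrite partialD; [|exact: smooth_partials|].
  rewrite partialM; [|by apply: smooth_partials; exact: smooth_cst|exact: smooth_partials].
  by rewrite partial_cst; apply/funext => x; rewrite mul0r add0r.
exact: smooth_partials (smoothM (smooth_cst t) sg).
Qed.

Lemma continuous_coord (i : 'I_n) : continuous (fun x : 'rV[R]_n => x ord0 i).
Proof. exact: coord_continuous. Qed.

Definition expdot (xi x : 'rV[R]_n) : R := expR (\sum_i xi ord0 i * x ord0 i).

Let dot (xi x : 'rV[R]_n) : R := \sum_i xi ord0 i * x ord0 i.

Let dot_line xi x t i :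
  dot xi (t *: delta_mx ord0 i + x) = dot xi x + t * xi ord0 i.
Proof.
rewrite /dot; under eq_bigr do rewrite !mxE eqxx/= mulrDr.
rewrite big_split/= addrC; congr (_ + _).
rewrite (bigD1 i)//= eqxx mulr1 big1 ?addr0 1?mulrC// => j /negbTE ->.
by rewrite !mulr0.
Qed.

Let expdot_is_derive xi x i :
  is_derive x (delta_mx ord0 i) (expdot xi) (xi ord0 i * expdot xi x).
Proof. by apply: (is_derive_comp_affine (L := dot xi)) => // t; exact: dot_line. Qed.

Lemma partial_expdot xi i : partial i (expdot xi) = fun x => xi ord0 i * expdot xi x.
Proof. by apply/funext => x; exact: derive_val. Qed.

Lemma expdotD xi eta x : expdot (xi + eta) x = expdot xi x * expdot eta x.
Proof.
rewrite /expdot -expRD -big_split/=; congr expR.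
by apply: eq_bigr => i _; rewrite mxE mulrDl.
Qed.

Lemma smooth_expdot xi : smooth (expdot xi).
Proof.
apply/smoothP; elim=> [|k IH].
  move=> x; apply: continuous_comp; last exact: continuous_expR.
  move: x; elim: (index_enum _) => [|i s IH] x.
    rewrite (_ : (fun _ => _) = fun=> 0); first exact: cst_continuous.
    by apply/funext => y; rewrite big_nil.
  rewrite (_ : (fun _ => _) =
      fun y : 'rV_n => xi ord0 i * y ord0 i + \sum_(j <- s) xi ord0 j * y ord0 j).
    apply: cvgD (IH x); apply: cvgM; first exact: cst_continuous.
    exact: continuous_coord.
  by apply/funext => y; rewrite big_cons.
split; [exact: (Ck_continuous IH)|by move=> i x; case: (expdot_is_derive xi x i)|].
by move=> i; rewrite partial_expdot; apply: CkM => //; exact: Ck_cst.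
Qed.

End Ck_functions.

(** * The flat function exp(-1/t) *)

Section flat_function.
Variable R : realType.
Implicit Types (p : {poly R}) (t : R).

(** p(1/t) exp(-1/t) extended by 0: a family stable under differentiation. *)
Definition flat p t : R := if 0 < t then p.[t^-1] * expR (- t^-1) else 0.

(* A polynomial times exp(-y) is bounded on [0, +oo), by expanding into
   monomials and bounding each by a term of the exponential series. *)
Let poly_expRN_bounded p : exists2 C : R, 0 <= C &
  forall y, 0 <= y -> `|p.[y] * expR (- y)| <= C.
Proof.
have mono k : exists2 C : R, 0 <= C & forall y : R, 0 <= y -> y ^+ k * expR (- y) <= C.
  exists k`!%:R => // y y0; rewrite expRN ler_pdivrMr ?expR_gt0//.
  case: k => [|k].
    by rewrite expr0 mul1r (le_trans _ (expR_ge1Dx y))// lerDl.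
  rewrite mulrC -ler_pdivrMr ?ltr0n ?fact_gt0//.
  by apply: le_trans (expR_ge1Dxn k y0); rewrite lerDr.
suff H k : exists2 C : R, 0 <= C &
    forall y : R, 0 <= y -> `|(\poly_(i < k) p`_i).[y] * expR (- y)| <= C.
  have [C C0 HC] := H (size p); exists C => // y y0.
  by have := HC y y0; rewrite coefK.
elim: k => [|k [C C0 IH]].
  by exists 0 => // y _; rewrite poly_def big_ord0 horner0 mul0r normr0.
have [D D0 HD] := mono k.
exists (C + `|p`_k| * D) => [|y y0]; first by rewrite addr_ge0// mulr_ge0.
rewrite poly_def big_ord_recr/= -poly_def hornerD mulrDl.
rewrite (le_trans (ler_normD _ _))// lerD ?IH// hornerZ hornerXn -mulrA normrM.
by rewrite ler_wpM2l// ger0_norm ?HD// mulr_ge0 ?exprn_ge0 ?expR_ge0.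
Qed.

(* The quadratic bound gives differentiability at 0, with derivative 0. *)
Let flat_sqr p : exists2 C, 0 < C & forall t, `|flat p t| <= C * t ^+ 2.
Proof.
have [C C0 HC] := poly_expRN_bounded ('X^2 * p).
exists (C + 1) => [|t]; first by rewrite ltr_wpDl.
rewrite /flat; case: ifPn => t0; last by rewrite normr0 mulr_ge0 ?sqr_ge0 ?addr_ge0.
have t2 : 0 < t ^+ 2 by rewrite exprn_gt0.
have := HC t^-1; rewrite invr_ge0 (ltW t0) => /(_ isT).
rewrite hornerM hornerXn -mulrA normrM.
rewrite [`|_ ^+ 2|]ger0_norm ?exprn_ge0 ?invr_ge0 ?(ltW t0)//.
rewrite exprVn ler_pdivrMl// => h; apply: (le_trans h).
by rewrite mulrC ler_wpM2r ?(ltW t2)// lerDl.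
Qed.

Lemma is_derive_flat p t :
  is_derive t 1 (flat p) (flat ('X^2 * (p - p^`())) t).
Proof.
have [t0|t0|<-] := ltgtP 0 t.
- rewrite {2}/flat t0.
  have := @near_eq_is_derive R _ _ (fun s : R => p.[s^-1] * expR (- s^-1)) (flat p) t 1.
  apply.
    near=> s; rewrite /flat; case: ifPn => //; rewrite -leNgt => s0.
    suff : 0 < s by rewrite ltNge s0.
    by near: s; exact: lt_nbhsr.
  have tn : t != 0 by rewrite gt_eqF.
  have dinv : is_derive t 1 (fun s : R => s^-1) (- t ^- 2).
    apply: is_derive_eq; first exact: (@is_deriveV _ id t 1 1).
    by rewrite [_ *: _]mulr1.
  have d1 : is_derive t 1 (fun s : R => p.[s^-1]) (p^`().[t^-1] * - t ^- 2).
    exact: (@is_derive1_comp _ (horner p) (fun s : R => s^-1)).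
  have d2 : is_derive t 1 (fun s : R => expR (- s^-1)) (expR (- t^-1) * - - t ^- 2).
    exact: (@is_derive1_comp _ expR (fun s : R => - s^-1)).
  apply: is_derive_eq (is_deriveM d1 d2) _.
  rewrite !hornerE/= exprVn.
  transitivity (p.[t^-1] * (expR (- t^-1) * - - t ^- 2) +
                expR (- t^-1) * (p^`().[t^-1] * - t ^- 2)) => //.
  by rewrite opprK; ring.
- have -> : flat ('X^2 * (p - p^`())) t = 0 by rewrite /flat ltNge (ltW t0).
  apply: (@near_eq_is_derive R _ _ (cst 0) (flat p)) => //.
  near=> s; rewrite /flat; case: ifPn => // s0.
  suff : s < 0 by rewrite ltNge ltW.
  by near: s; exact: lt_nbhsl.
- have [C C0 HC] := flat_sqr p.
  have f0 q : flat q 0 = 0 by rewrite /flat ltxx.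
  rewrite f0.
  have H : h^-1 *: ((flat p \o shift 0) (h *: 1) - flat p 0) @[h --> 0^'] --> 0.
    apply/cvgrPdist_le => /= e e0; near=> h.
    have h0 : h != 0 by near: h; exact: nbhs_dnbhs_neq.
    rewrite f0 subr0 addr0 [h *: 1]mulr1 sub0r normrN normrM normfV.
    rewrite ler_pdivrMl ?normr_gt0// mulrC.
    apply: (le_trans (HC h)); rewrite -real_normK ?num_real// expr2 mulrA.
    rewrite ler_wpM2r// mulrC -ler_pdivlMr//.
    by near: h; apply: dnbhs0_le; rewrite divr_gt0.
  apply: DeriveDef; first by apply/cvg_ex; exists 0.
  exact: cvg_lim H.
Unshelve. all: by end_near. Qed.

Lemma smooth_flat n p (i : 'I_n) (c a : R) :
  smooth (fun x : 'rV[R]_n => flat p (c * (x ord0 i - a))).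
Proof.
apply/smoothP => k; elim: k p => [|k IH] p.
  move=> x; apply: (@continuous_comp _ _ _ (fun x : 'rV[R]_n => c * (x ord0 i - a))).
    have : @Ck R n 0 (fun x => c * (x ord0 i + - a)).
      apply: (@CkM R n 0); first exact: (@Ck_cst R n 0).
      apply: (@CkD R n 0); last exact: (@Ck_cst R n 0).
      exact: continuous_coord.
    by apply.
  apply/differentiable_continuous/derivable1_diffP.
  by case: (is_derive_flat p (c * (x ord0 i - a))).
pose L (x : 'rV[R]_n) := c * (x ord0 i - a).
have D x j : is_derive x (delta_mx ord0 j) (flat p \o L)
    ((c * (j == i)%:R) * flat ('X^2 * (p - p^`())) (L x)).
  apply: is_derive_comp_affine; last exact: is_derive_flat.
  by move=> t; rewrite /L !mxE eqxx/= eq_sym; ring.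
split.
- exact: (Ck_continuous (IH p)).
- by move=> j x; case: (D x j).
- move=> j; rewrite (_ : partial j _ =
    fun x => (c * (j == i)%:R) * flat ('X^2 * (p - p^`())) (L x)).
    by apply: CkM; [exact: Ck_cst|exact: IH].
  by apply/funext => x; have [_] := D x j.
Qed.

End flat_function.

(** * Borel sets and boxes of R^n *)

Section boxes.
Variables (R : realType) (n : nat).
Implicit Types (a b x : 'rV[R]_n) (U : set 'rV[R]_n).
Notation mu := (lebesgue_rV R n).

Definition obox a b : set 'rV[R]_n :=
  [set x | forall i, a ord0 i < x ord0 i < b ord0 i].

Definition cbox a b : set 'rV[R]_n :=
  [set x | forall i, x ord0 i \in `[a ord0 i, b ord0 i]].

Lemma obox_cbox a b : obox a b `<=` cbox a b.
Proof. by move=> x ab i; rewrite in_itv/=; have /andP[/ltW -> /ltW ->] := ab i. Qed.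

Lemma measurable_coord_setI (P : 'I_n -> set R) :
  (forall i, measurable (P i)) ->
  measurable [set x : 'rV[R]_n | forall i, P i (x ord0 i)].
Proof.
move=> mP; rewrite (_ : mkset _ =
    \bigcap_(i in [set: 'I_n]) (rV_coord i @^-1` P i)); last first.
  by apply/seteqP; split => [x h i _|x h i]; [exact: h|exact: (h i I)].
apply: fin_bigcap_measurable => [|i _]; first exact: finite_finset.
by rewrite -[X in measurable X]setTI; apply: measurable_rV_coord => //; exact: mP.
Qed.

Lemma measurable_obox a b : measurable (obox a b).
Proof.
rewrite (_ : obox a b = [set x | forall i, `]a ord0 i, b ord0 i[%classic (x ord0 i)]).
  by apply: (measurable_coord_setI (P := fun i => `]a ord0 i, b ord0 i[%classic)).
by apply/seteqP; split => x /= h i; have := h i; rewrite in_itv.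
Qed.

Lemma measurable_cbox a b : measurable (cbox a b).
Proof.
by apply: (measurable_coord_setI (P := fun i => `[a ord0 i, b ord0 i]%classic)).
Qed.

Lemma compact_cbox a b : compact (cbox a b).
Proof.
by apply: (@rV_compact R n (fun i => `[a ord0 i, b ord0 i]%classic)) => i; exact: segment_compact.
Qed.

Definition rat_box (k : nat) : 'rV[R]_n * 'rV[R]_n :=
  let pq := odflt (0, 0) (@unpickle ('rV[rat]_n * 'rV[rat]_n)%type k) in
  (map_mx ratr pq.1, map_mx ratr pq.2).

(** Countability is what makes open sets Borel, and what lets null sets be
    collected over all boxes; the closed boxes inside U serve later as compact
    supports. *)
Lemma open_bigcup_obox U : open U ->
  U = \bigcup_(k in [set k | cbox (rat_box k).1 (rat_box k).2 `<=` U])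
        obox (rat_box k).1 (rat_box k).2.
Proof.
move=> oU; apply/seteqP; split => [x Ux|x [k /= kU /obox_cbox]]; last exact: kU.
have /nbhs_ballP[e /= e0 xeU] : nbhs x U by exact: open_nbhs_nbhs.
have Hp i : exists q, ratr q \in `](x ord0 i - e), x ord0 i[.
  by apply: rat_in_itvoo; rewrite ltrBlDr ltrDl.
have Hq i : exists q, ratr q \in `]x ord0 i, (x ord0 i + e)[.
  by apply: rat_in_itvoo; rewrite ltrDl.
pose p : 'rV[rat]_n := \row_i projT1 (cid (Hp i)).
pose q : 'rV[rat]_n := \row_i projT1 (cid (Hq i)).
have pP i : x ord0 i - e < ratr (p ord0 i) < x ord0 i.
  by rewrite mxE; case: cid => r /=; rewrite in_itv.
have qP i : x ord0 i < ratr (q ord0 i) < x ord0 i + e.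
  by rewrite mxE; case: cid => r /=; rewrite in_itv.
exists (pickle (p, q)); rewrite /rat_box /= ?pickleK /=.
  move=> y yb; apply: xeU; split => // i j; rewrite ord1.
  have := yb j; have := pP j; have := qP j; rewrite in_itv/= !mxE.
  move=> /andP[_ xq] /andP[px _] /andP[py yq].
  rewrite /ball/= ltr_distlC; apply/andP; split.
    by rewrite (lt_le_trans px).
  by rewrite (le_lt_trans yq).
move=> i; have := pP i; have := qP i; rewrite !mxE.
by move=> /andP[-> _] /andP[_ ->].
Qed.

Lemma open_measurable_rV U : open U -> measurable U.
Proof.
move=> /open_bigcup_obox ->; apply: bigcup_measurable => k _.
exact: measurable_obox.
Qed.

Lemma compact_measurable_rV U : compact U -> measurable U.
Proof.
move=> cU; rewrite -[U]setCK; apply: measurableC; apply: open_measurable_rV.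
by apply: closed_openC; apply: compact_closed cU; exact: norm_hausdorff.
Qed.

Lemma continuous_measurable_rV (f : 'rV[R]_n -> R) (D : set 'rV[R]_n) :
  continuous f -> measurable D -> measurable_fun D f.
Proof.
move=> /continuousP cf mD; apply: (measurability _ (RGenOpens.measurableE R)).
move=> _ [_ [a [b ->] <-]]; apply: measurableI => //.
by apply: open_measurable_rV; exact/cf/interval_open.
Qed.

Definition cube (M : R) := cbox (const_mx (- M)) (const_mx M).

Lemma cubeP M x : cube M x <-> forall i, `|x ord0 i| <= M.
Proof.
by split => h i; have := h i; rewrite in_itv/= !mxE ler_norml.
Qed.

Lemma cube_lty M : (mu (cube M) < +oo)%E.
Proof.
have [M0|M0] := leP 0 M.
  rewrite lebesgue_rV_box ?ltry// => i; rewrite !mxE.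
  by rewrite (le_trans _ M0)// oppr_le0.
apply: (@le_lt_trans _ _ (mu (cube 0))); last first.
  by rewrite lebesgue_rV_box ?ltry// => i; rewrite !mxE oppr0.
apply: le_measure; rewrite ?inE; [exact: measurable_cbox|exact: measurable_cbox|].
by move=> x /cubeP h; apply/cubeP => i; rewrite (le_trans (h i))// ltW.
Qed.

Lemma bounded_cube U : bounded_set U -> exists2 M, 0 < M & U `<=` cube M.
Proof.
move=> [M [_ HM]]; exists (`|M| + 1) => [|x Ux]; first by rewrite ltr_wpDl.
apply/cubeP => i; have /= := HM (`|M| + 1) _ x Ux.
have -> : M < `|M| + 1 by rewrite (le_lt_trans (ler_norm M))// ltrDl.
move=> /(_ isT); apply: le_trans.
by rewrite [leRHS]/Num.Def.normr/= mx_normrE; apply: (le_bigmax _ _ (ord0, i)).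
Qed.

Lemma compact_cube U : compact U -> exists2 M, 0 < M & U `<=` cube M.
Proof. by move=> cU; apply: bounded_cube; exact: compact_bounded. Qed.

Lemma bounded_lty U : measurable U -> bounded_set U -> (mu U < +oo)%E.
Proof.
move=> mU /bounded_cube[M _ UM]; apply: le_lt_trans (cube_lty M).
by apply: le_measure; rewrite ?inE//; exact: measurable_cbox.
Qed.

Lemma continuous_bounded (f : 'rV[R]_n -> R) M : continuous f ->
  exists2 C, 0 < C & forall x, cube M x -> `|f x| <= C.
Proof.
move=> cf; have : compact (f @` cube M).
  by apply: continuous_compact; [exact: continuous_subspaceT|exact: compact_cbox].
move=> /compact_bounded[C [_ HC]]; exists (`|C| + 1) => [|x Mx]; first by rewrite ltr_wpDl.
by apply: HC; [rewrite (le_lt_trans (ler_norm C))// ltrDl|exists x].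
Qed.

Lemma continuous_integrable_rV (f : 'rV[R]_n -> R) M : continuous f ->
  (forall x, f x != 0 -> cube M x) -> mu.-integrable setT (EFin \o f).
Proof.
move=> cf fM.
have mM : measurable (cube M) by exact: measurable_cbox.
have -> : EFin \o f = (EFin \o f) \_ (cube M).
  apply/funext => x; rewrite patchE; case: ifPn => // /negP xM /=.
  by have [->//|/fM] := eqVneq (f x) 0; move=> h; exfalso; apply: xM; rewrite inE.
rewrite -integrable_mkcond//.
have [C C0 HC] := continuous_bounded M cf.
apply: measurable_bounded_integrable => //; first exact: cube_lty.
  exact: continuous_measurable_rV.
exists C; split; first exact: num_real.
by move=> D CD x /HC /le_trans; apply; exact: ltW.
Qed.

End boxes.

(** * Integration by parts *)

Lemma continuous_rV_cons (R : realType) n (y : 'rV[R]_n) :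
  continuous (fun t : R => rV_cons (t, y)).
Proof.
move=> t; apply/cvg_ballP => e e0; apply: filterS (nbhsx_ballx t e e0) => s ts.
split => // i j; rewrite ord1; have [k ->|->] := unliftP ord0 j.
  by rewrite !rV_consES; exact: ballxx.
by rewrite !rV_consE0.
Qed.

Lemma continuous_rV_cons_r (R : realType) n (t : R) :
  continuous (fun y : 'rV[R]_n => rV_cons (t, y)).
Proof.
move=> y; apply/(@cvg_ballP _ _ _ _ (nbhs_filter y)) => e e0.
apply: (filterS _ (nbhsx_ballx y e e0)) => z [_ yz].
split => // i j; rewrite ord1; have [k ->|->] := unliftP ord0 j.
  by rewrite !rV_consES; exact: yz.
by rewrite !rV_consE0; exact: ballxx.
Qed.

Lemma cube_cons (R : realType) n M (t : R) (y : 'rV[R]_n) :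
  cube M (rV_cons (t, y)) -> `|t| <= M /\ cube M y.
Proof.
move=> /cubeP h; split; first by have := h ord0; rewrite rV_consE0.
by apply/cubeP => i; have := h (lift ord0 i); rewrite rV_consES.
Qed.

(** The integral is taken over an interval whose endpoints lie outside the
    support, where the primitive f vanishes. *)
Lemma integral_deriv_eq0 (R : realType) (f d : R -> R) (M : R) :
  (forall t : R, is_derive t 1 f (d t)) -> continuous d ->
  (forall t, f t != 0 -> `|t| <= M) -> (forall t, d t != 0 -> `|t| <= M) ->
  (\int[lebesgue_measure]_t (d t)%:E = 0)%E.
Proof.
move=> df cd fM dM; pose N := `|M| + 1.
have N0 : 0 < N by rewrite ltr_wpDl.
have MN : M < N by rewrite (le_lt_trans (ler_norm M))// ltrDl.
have cf (t : R) : {for t, continuous f}.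
  by apply/differentiable_continuous/derivable1_diffP; case: (df t).
have fN : f N = 0.
  by apply/eqP; apply: contraTT MN => /fM; rewrite -leNgt gtr0_norm.
have fNN : f (- N) = 0.
  by apply/eqP; apply: contraTT MN => /fM; rewrite -leNgt normrN gtr0_norm.
have -> : (fun t : R => (d t)%:E) = (fun t : R => (d t)%:E) \_ `[- N, N].
  apply/funext => t; rewrite patchE; case: ifPn => // /negP tN.
  have [->//|/dM h] := eqVneq (d t) 0; exfalso; apply: tN.
  by rewrite inE/= in_itv/= -ler_norml (le_trans h)// ltW.
rewrite -integral_mkcond (@continuous_FTC2 _ d f).
- by rewrite fN fNN subee.
- by rewrite gtrN.
- exact: continuous_subspaceT.
- split.
  + by move=> t _; case: (df t).
  + exact/cvg_at_right_filter/cf.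
  + exact/cvg_at_left_filter/cf.
- by move=> t _; rewrite derive1E; have [] := df t.
Qed.

(** The divergence theorem for compactly supported functions: Fubini reduces
    it to the derivative in the first coordinate, which integrates to zero by
    the fundamental theorem of calculus. *)
Lemma integral_partial_eq0 (R : realType) n (f d : 'rV[R]_n -> R) (i : 'I_n) M :
  (forall x, is_derive x (delta_mx ord0 i) f (d x)) ->
  continuous d ->
  (forall x, f x != 0 -> cube M x) -> (forall x, d x != 0 -> cube M x) ->
  (\int[lebesgue_rV R n]_x (d x)%:E = 0)%E.
Proof.
elim: n f d i => [|n IH] f d i df cd fM dM; first by case: i df.
have di := continuous_integrable_rV cd dM.
have md : measurable_fun [set: 'rV[R]_n.+1] (fun x : 'rV[R]_n.+1 => (d x)%:E).
  by apply/measurable_EFinP; exact: continuous_measurable_rV.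
pose h (z : measurableTypeR R * 'rV[R]_n) : \bar R := (d (rV_cons z))%:E.
have mh : measurable_fun setT h.
  by apply: (measurableT_comp md); exact: (@measurable_rV_cons R n).
have ih : (lebesgue_measure \x lebesgue_rV R n)%E.-integrable setT h.
  apply/integrableP; split => //; have /integrableP[_] := di.
  rewrite /= /lebesgue_rV_step ge0_integral_pushforward//.
    exact: (@measurable_rV_cons R n).
  apply/measurable_EFinP; apply: measurableT_comp => //.
  exact: continuous_measurable_rV.
have -> : (\int[lebesgue_rV R n.+1]_x (d x)%:E =
    \int[lebesgue_measure \x lebesgue_rV R n]_z h z)%E.
  rewrite /= /lebesgue_rV_step (@integral_pushforward _ _ _ _ _ (@rV_cons R n))//.
  exact: (@measurable_rV_cons R n).
have cons_line (t : R) (y : 'rV[R]_n) (s : R) :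
    s *: delta_mx ord0 ord0 + rV_cons (t, y) = rV_cons (s + t, y).
  apply/rowP => j; rewrite [LHS]mxE; have [k ->|->] := unliftP ord0 j.
    by rewrite !rV_consES !mxE/= mulr0 add0r.
  by rewrite !rV_consE0 !mxE/= mulr1.
have cons_lift (t : R) (y : 'rV[R]_n) (s : R) j :
    s *: delta_mx ord0 (lift ord0 j) + rV_cons (t, y) =
    rV_cons (t, s *: delta_mx ord0 j + y).
  apply/rowP => k; rewrite [LHS]mxE; have [l ->|->] := unliftP ord0 k.
    by rewrite !rV_consES !mxE/= (inj_eq lift_inj).
  by rewrite !rV_consE0 !mxE/= mulr0 add0r.
have [j ij|i0] := unliftP ord0 i.
- rewrite -integral12_prod_meas1//; apply: integral0_eq => t _.
  apply: (IH (fun y => f (rV_cons (t, y))) (fun y => d (rV_cons (t, y))) j).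
  + move=> y; apply/is_derive_lineP; have := df (rV_cons (t, y)); rewrite ij.
    move=> /is_derive_lineP; congr is_derive.
    by apply/funext => s; rewrite cons_lift.
  + move=> y; apply: (@continuous_comp _ _ _ (fun y => rV_cons (t, y)) d).
      exact: continuous_rV_cons_r.
    exact: cd.
  + by move=> y /fM /cube_cons[].
  + by move=> y /dM /cube_cons[].
- rewrite -integral21_prod_meas1//; apply: integral0_eq => y _.
  apply: (@integral_deriv_eq0 _ (fun t => f (rV_cons (t, y))) (fun t => d (rV_cons (t, y))) M).
  + move=> t; apply/is_derive_lineP; have := df (rV_cons (t, y)); rewrite i0.
    move=> /is_derive_lineP; congr is_derive.
    by apply/funext => s; rewrite cons_line [s *: 1]mulr1.
  + move=> t; apply: (@continuous_comp _ _ _ (fun t : R => rV_cons (t, y)) d).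
      exact: continuous_rV_cons.
    exact: cd.
  + by move=> t /fM /cube_cons[].
  + by move=> t /dM /cube_cons[].
Qed.

(** * Functions determined by their integrals *)

Lemma Rdominated_cvg d (T : measurableType d) (R : realType)
    (mu : {measure set T -> \bar R}) (D : set T) (f_ : (T -> R)^nat)
    (f g : T -> R) : measurable D ->
  (forall k, measurable_fun D (f_ k)) -> measurable_fun D f ->
  (forall x, D x -> f_ k x @[k --> \oo] --> f x) ->
  mu.-integrable D (EFin \o g) ->
  (forall k x, D x -> `|f_ k x| <= g x) ->
  \int[mu]_(x in D) f_ k x @[k --> \oo] --> \int[mu]_(x in D) f x.
Proof.
move=> mD mf_ mf f_f ig f_g.
have [|||//||fi _ H] := @dominated_convergence _ _ _ mu D mD
    (fun k => EFin \o f_ k) (EFin \o f) (EFin \o g).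
- by move=> k; exact/measurable_EFinP.
- exact/measurable_EFinP.
- by apply: aeW => x Dx; apply: cvg_EFin; [exact: nearW|exact: f_f].
- by apply: aeW => x k Dx /=; rewrite lee_fin f_g.
- by apply: fine_cvg; rewrite fineK//; exact: integrable_fin_num.
Qed.

Section orthants.
Variables (R : realType) (n : nat).
Implicit Types (c x : 'rV[R]_n).
Notation mu := (lebesgue_rV R n).

Definition orthant c : set 'rV[R]_n := [set x | forall i, x ord0 i < c ord0 i].

Let G : set (set 'rV[R]_n) := range orthant.

Let orthantI : setI_closed G.
Proof.
move=> _ _ [a _ <-] [b _ <-].
exists (\row_i Num.min (a ord0 i) (b ord0 i)) => //.
apply/seteqP; split => x /=.
  by move=> h; split => i; have := h i; rewrite mxE lt_min => /andP[].
by move=> [ha hb] i; rewrite mxE lt_min ha hb.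
Qed.

Lemma measurable_orthant c : measurable (orthant c).
Proof.
rewrite (_ : orthant c = [set x | forall i, `]-oo, c ord0 i[%classic (x ord0 i)]).
  by apply: (measurable_coord_setI (P := fun i => `]-oo, c ord0 i[%classic)).
by apply/seteqP; split => x /= h i; have := h i; rewrite in_itv.
Qed.

Let orthant_gen : @measurable _ 'rV[R]_n = <<s G >>.
Proof.
apply/seteqP; split; last first.
  apply: smallest_sub; first exact: sigma_algebra_measurable.
  by move=> _ [c _ <-]; exact: measurable_orthant.
apply: smallest_sub; first exact: smallest_sigma_algebra.
move=> B; rewrite -bigcup_seq => -[i _ [A mA <-]].
pose f : g_sigma_algebraType G -> measurableTypeR R := fun x => x ord0 i.
suff mf : measurable_fun setT f by exact: (mf measurableT _ mA).
apply: (measurability _ (RGenInftyO.measurableE R)).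
move=> _ [_ [c ->] <-]; rewrite setTI.
pose ck k : 'rV[R]_n := \row_j if j == i then c else k%:R.
rewrite (_ : _ @^-1` _ = \bigcup_k orthant (ck k)).
  by apply: bigcupT_measurable => k; apply: sub_sigma_algebra; exists (ck k).
apply/seteqP; split => x /=; rewrite /f in_itv/=; last first.
  by move=> [k _ /(_ i)]; rewrite mxE eqxx.
move=> xc; exists (Num.bound `|x|) => // j; rewrite mxE; case: eqP => [->//|_].
apply: le_lt_trans (archi_boundP (normr_ge0 x)).
apply: le_trans (ler_norm _) _.
by rewrite [leRHS]/Num.Def.normr/= mx_normrE; apply: (le_bigmax _ _ (ord0, j)).
Qed.

(** The orthants form a pi-system generating the Borel sets, so that a function
    whose integrals over them vanish is null almost everywhere. *)
Lemma ae_eq0_orthant (D : set 'rV[R]_n) (h : 'rV[R]_n -> R) : measurable D ->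
  mu.-integrable D (EFin \o h) ->
  (forall c, \int[mu]_(x in D `&` orthant c) h x = 0) ->
  {ae mu, forall x, D x -> h x = 0}.
Proof.
move=> mD ih h0; have /integrableP[/measurable_EFinP mh _] := ih.
have iDS S : measurable S -> mu.-integrable (D `&` S) (EFin \o h).
  by move=> mS; apply: integrableS ih => //; exact: measurableI.
(* the orthants exhaust R^n *)
have hT : \int[mu]_(x in D) h x = 0.
  suff H : \int[mu]_(x in D) (h \_ (orthant (const_mx k%:R))) x @[k --> \oo]
      --> \int[mu]_(x in D) h x.
    rewrite -(cvg_lim (@Rhausdorff R) H); apply: lim_near_cst => //.
    by apply: nearW => k; rewrite -Rintegral_mkcondr.
  apply: (@Rdominated_cvg _ _ _ _ _ _ _ (fun x => `|h x|)) => //.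
  + move=> k; apply/measurable_restrict => //; first exact: measurable_orthant.
    exact: measurable_funS mh.
  + move=> x Dx; apply: cvg_near_cst; near=> k.
    rewrite patchE mem_set// => i; rewrite mxE.
    apply: (@le_lt_trans _ _ `|x|).
      apply: le_trans (ler_norm _) _; rewrite [leRHS]/Num.Def.normr/= mx_normrE.
      exact: (le_bigmax _ _ (ord0, i)).
    near: k; exact: nbhs_infty_gtr.
  + exact: integrable_norm.
  + by move=> k x Dx; rewrite patchE; case: ifPn => // _; rewrite normr0.
pose P S := \int[mu]_(x in D `&` S) h x = 0.
have H S : measurable S -> P S.
  rewrite orthant_gen; move: S; apply: (@dynkin_induction _ _ G P) => //.
  - by rewrite /P setIT.
  - by move=> _ [c _ <-]; exact: h0.
  - rewrite /P => S mS PS.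
    have := @Rintegral_setU _ _ _ mu (D `&` S) (D `&` ~` S) h.
    rewrite -setIUr setUv setIT hT PS add0r => <- //.
    + exact: measurableI.
    + by apply: measurableI => //; exact: measurableC.
    + by apply/disj_setPS => x [[_ Sx] [_]].
  - move=> F mF tF PF; rewrite /P /Rintegral setI_bigcupr integral_bigcup.
    + rewrite eseries0// => k _ _; have /eqP := PF k.
      rewrite /Rintegral fine_eq0 => [/eqP//|].
      by apply: integrable_fin_num; [exact: measurableI|exact: iDS].
    + exact: trivIset_setIl.
    + by move=> k; exact: measurableI.
    + by rewrite -setI_bigcupr; apply: iDS; exact: bigcupT_measurable.
have : ae_eq mu D (EFin \o h) (cst 0%E).
  apply: integral_ae_eq => // E ED mE; rewrite integral0.
  have := H E mE; rewrite /P setIidr// /Rintegral => /eqP; rewrite fine_eq0.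
    by move=> /eqP.
  by apply: integrable_fin_num => //; exact: integrableS ih.
by apply: filterS => x h0x Dx; have := h0x Dx => -[].
Unshelve. all: by end_near. Qed.

End orthants.

(** * Test functions *)

Lemma integrable_mul_bounded d (T : measurableType d) (R : realType)
    (mu : {measure set T -> \bar R}) (D : set T) (w f : T -> R) (C : R) :
  measurable D -> mu.-integrable D (EFin \o w) -> measurable_fun D f ->
  (forall x, D x -> `|f x| <= C) ->
  mu.-integrable D (EFin \o (fun x => w x * f x)).
Proof.
move=> mD iw mf fC; apply: (integrableMl mD iw mf).
exists C; split; first exact: num_real.
by move=> E CE x /fC /le_trans; apply; exact: ltW.
Qed.

Lemma cvg_bigprod (R : realType) (I : Type) (s : seq I) (F : I -> R^nat) (l : I -> R) :
  (forall i, F i k @[k --> \oo] --> l i) ->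
  (\prod_(i <- s) F i k) @[k --> \oo] --> \prod_(i <- s) l i.
Proof.
move=> Fl; elim: s => [|i s IH].
  by rewrite big_nil; apply: cvg_near_cst; apply: nearW => k; rewrite big_nil.
rewrite big_cons (_ : (fun _ => _) = fun k => F i k * \prod_(j <- s) F j k).
  exact: cvgM.
by apply/funext => k; rewrite big_cons.
Qed.

Lemma integrable_scale d (T : measurableType d) (R : realType)
    (mu : {measure set T -> \bar R}) (D : set T) (f : T -> R) (t : R) :
  measurable D -> mu.-integrable D (EFin \o f) ->
  mu.-integrable D (EFin \o (fun x => t * f x)).
Proof. by move=> mD fi; exact: (integrableZl mD t fi). Qed.

Lemma integrable_lin d (T : measurableType d) (R : realType)
    (mu : {measure set T -> \bar R}) (D : set T) (f g : T -> R) (t : R) :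
  measurable D -> mu.-integrable D (EFin \o f) -> mu.-integrable D (EFin \o g) ->
  mu.-integrable D (EFin \o (fun x => f x + t * g x)).
Proof.
by move=> mD fi gi; exact: (integrableD mD fi (integrable_scale t mD gi)).
Qed.

Lemma Rintegral_lin d (T : measurableType d) (R : realType)
    (mu : {measure set T -> \bar R}) (D : set T) (f g : T -> R) (t : R) :
  measurable D -> mu.-integrable D (EFin \o f) -> mu.-integrable D (EFin \o g) ->
  \int[mu]_(x in D) (f x + t * g x) =
  \int[mu]_(x in D) f x + t * \int[mu]_(x in D) g x.
Proof.
move=> mD fi gi; rewrite -RintegralZl// -RintegralD//.
exact: integrable_scale.
Qed.

Section bump.
Variables (R : realType) (n : nat).
Implicit Types (a b x : 'rV[R]_n).

Let flat1_ge0 (t : R) : 0 <= flat 1 t.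
Proof. by rewrite /flat; case: ifP => // _; rewrite hornerC mul1r expR_ge0. Qed.

Let flat1_le1 (t : R) : flat 1 t <= 1.
Proof.
rewrite /flat; case: ifP => // t0; rewrite hornerC mul1r expR_le1.
by rewrite oppr_le0 invr_ge0 ltW.
Qed.

Let flat1_neq0 (t : R) : flat 1 t != 0 -> 0 < t.
Proof. by rewrite /flat; case: ifP => //; rewrite eqxx. Qed.

Let cvg_flat1 (t : R) : 0 < t -> flat 1 (k.+1%:R * t) @[k --> \oo] --> (1 : R).
Proof.
move=> t0; rewrite (_ : (fun k => _) = fun k => expR (- (t^-1 * k.+1%:R^-1))).
  rewrite -[X in _ --> X]expR0; apply: continuous_cvg; first exact: continuous_expR.
  rewrite -oppr0; apply: cvgN; rewrite -[X in _ --> X](mulr0 t^-1).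
  by apply: cvgMr; exact: cvg_harmonic.
by apply/funext => k; rewrite /flat mulr_gt0// hornerC mul1r invfM mulrC.
Qed.

(** The factors of the k-th bump vanish outside the box, and inside it they are
    exp(-1/((k+1)t)) with t > 0, which tends to 1. *)
Definition bump a b (k : nat) x : R :=
  \prod_(i <- index_enum 'I_n)
    (flat 1 (k.+1%:R * (x ord0 i - a ord0 i)) *
     flat 1 (- k.+1%:R * (x ord0 i - b ord0 i))).

Lemma smooth_bump a b k : smooth (bump a b k).
Proof. by apply: smooth_prod => i; apply: smoothM; exact: smooth_flat. Qed.

Lemma bump_le1 a b k x : `|bump a b k x| <= 1.
Proof.
rewrite /bump; elim/big_rec : _ => [|i y _ y1]; first by rewrite normr1.
rewrite 2!normrM -[leRHS]mulr1 -[X in _ <= X * _]mulr1 ler_pM//.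
by rewrite !ger0_norm// ler_pM.
Qed.

Lemma bump_neq0 a b k x : bump a b k x != 0 -> obox a b x.
Proof.
rewrite /bump prodf_seq_neq0 => /allP h i; have := h i (mem_index_enum i).
rewrite /= mulf_eq0 negb_or => /andP[/flat1_neq0 + /flat1_neq0].
rewrite pmulr_rgt0// subr_gt0 => ->.
by rewrite mulNr -mulrN pmulr_rgt0// opprB subr_gt0 => ->.
Qed.

Lemma cvg_bump a b x : bump a b k x @[k --> \oo] --> (\1_(obox a b) x : R).
Proof.
rewrite indicE; have [xab|xab] := pselect (obox a b x); last first.
  rewrite memNset//; apply: cvg_near_cst; apply: nearW => k.
  by apply/eqP; apply: contra_notT xab; exact: bump_neq0.
rewrite mem_set//= /bump.
rewrite (_ : 1%:R = \prod_(i <- index_enum 'I_n) (1 * 1 : R)); last first.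
  by rewrite mulr1 big1_eq.
apply: cvg_bigprod => i; have /andP[ax xb] := xab i.
apply: cvgM; first by apply: cvg_flat1; rewrite subr_gt0.
under eq_fun do rewrite mulNr -mulrN opprB.
by apply: cvg_flat1; rewrite subr_gt0.
Qed.

End bump.

Section test_functions.
Variables (R : realType) (n : nat) (Om : set 'rV[R]_n).
Implicit Types (f phi psi u w : 'rV[R]_n -> R).
Notation mu := (lebesgue_rV R n).
Notation supp f := (closure [set x | f x != 0]).

Lemma supp_subset f (K : set 'rV[R]_n) : compact K ->
  (forall x, f x != 0 -> K x) -> supp f `<=` K /\ compact (supp f).
Proof.
move=> cK fK; have clK : closed K by apply: compact_closed cK; exact: norm_hausdorff.
have sub : supp f `<=` K.
  by rewrite [K in _ `<=` K](closure_id K).1//; exact: closure_subset.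
by split => //; apply: subclosed_compact cK sub; exact: closed_closure.
Qed.

Lemma test_bump a b k : cbox a b `<=` Om -> test_function Om (bump a b k).
Proof.
move=> abO; have [sub cs] := @supp_subset (bump a b k) _ (compact_cbox (a := a) (b := b))
  (fun x xab => obox_cbox (bump_neq0 xab)).
by split; [exact: smooth_bump|exact: cs|exact: subset_trans sub abO].
Qed.

Lemma test_function_sub f phi : smooth f -> test_function Om phi ->
  (forall x, f x != 0 -> supp phi x) -> test_function Om f.
Proof.
move=> sf [_ cphi phiO] fphi; have [sub cf] := supp_subset cphi fphi.
by split => //; exact: subset_trans sub phiO.
Qed.

Lemma partial_supp f i x : partial i f x != 0 -> supp f x.
Proof.
apply: contra_neqP => xf; rewrite /partial.
have oC : open (~` supp f) by apply: closed_openC; exact: closed_closure.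
rewrite (@near_eq_derive _ _ _ f (cst 0)) ?derive_cst//.
have : nbhs x (~` supp f) by apply: open_nbhs_nbhs.
apply: filterS => y yf; apply/eqP; apply: contra_notT yf => fy.
exact: subset_closure.
Qed.

Lemma test_partial i phi : test_function Om phi -> test_function Om (partial i phi).
Proof.
move=> tphi; apply: (test_function_sub _ tphi); last exact: partial_supp.
by apply: smooth_partial; case: tphi.
Qed.

Lemma test_foldr s phi : test_function Om phi ->
  test_function Om (foldr (@partial R n) phi s).
Proof. by move=> tphi; elim: s => //= i s; exact: test_partial. Qed.

Lemma test_mul phi psi : test_function Om phi -> smooth psi ->
  test_function Om (fun x => phi x * psi x).
Proof.
move=> tphi spsi; apply: (test_function_sub _ tphi).
  by case: tphi => sphi _ _; exact: smoothM sphi spsi.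
move=> x; rewrite mulf_eq0 negb_or => /andP[phi0 _]; exact: subset_closure.
Qed.

Lemma test_lin phi psi (t : R) : test_function Om phi -> test_function Om psi ->
  test_function Om (fun x => phi x + t * psi x).
Proof.
move=> [sphi cphi phiO] [spsi cpsi psiO].
have H x : phi x + t * psi x != 0 -> (supp phi `|` supp psi) x.
  have [phi0|phi0 _] := eqVneq (phi x) 0; last by left; exact: subset_closure.
  rewrite phi0 add0r mulf_eq0 negb_or => /andP[_ psi0].
  by right; exact: subset_closure.
have [sub cf] := supp_subset (compactU cphi cpsi) H.
split; [|exact: cf|by move=> x /sub[/phiO|/psiO]].
exact: smoothD sphi (smoothM (smooth_cst t) spsi).
Qed.

Lemma test_supp_cube phi : test_function Om phi ->
  exists M, forall x, phi x != 0 -> cube M x.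
Proof.
move=> [_ /compact_cube[M _ HM] _]; exists M => x phix.
by apply: HM; exact: subset_closure.
Qed.

Lemma test_continuous phi : test_function Om phi -> continuous phi.
Proof. by move=> [/smooth_continuous]. Qed.

Lemma test_integrable phi : test_function Om phi -> mu.-integrable setT (EFin \o phi).
Proof.
move=> tphi; have [M HM] := test_supp_cube tphi.
exact: (continuous_integrable_rV (test_continuous tphi) HM).
Qed.

Lemma test_outside phi x : test_function Om phi -> ~ Om x -> phi x = 0.
Proof.
move=> [_ _ phiO] Ox; apply/eqP; apply: contra_notT Ox => phix.
by apply: phiO; exact: subset_closure.
Qed.

Hypothesis oOm : open Om.
Let mOm : measurable Om := open_measurable_rV oOm.

Lemma test_integrableO phi : test_function Om phi -> mu.-integrable Om (EFin \o phi).
Proof. by move=> /test_integrable; apply: integrableS. Qed.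

Lemma test_loc_integrable phi : test_function Om phi -> loc_integrable Om phi.
Proof.
move=> tphi; split.
  by apply: continuous_measurable_rV => //; exact: test_continuous tphi.
move=> K cK _; apply: integrableS (test_integrable tphi) => //.
exact: compact_measurable_rV.
Qed.

Lemma integral_test_partial i phi : test_function Om phi ->
  \int[mu]_(x in Om) partial i phi x = 0.
Proof.
move=> tphi; have [M HM] := test_supp_cube tphi.
have [N HN] := test_supp_cube (test_partial i tphi).
rewrite Rintegral_mkcond /Rintegral.
rewrite (_ : partial i phi \_ Om = partial i phi); last first.
  apply/funext => x; rewrite patchE; case: ifPn => // /negP; rewrite inE => xO.
  by rewrite (test_outside (test_partial i tphi)).
have D x : is_derive x (delta_mx ord0 i) phi (partial i phi x).
  by apply: is_derive_partial; case: tphi => /smooth_partials.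
have cubeS (A B : R) x : A <= B -> cube A x -> cube B x.
  by move=> AB /cubeP h; apply/cubeP => j; exact: le_trans (h j) AB.
rewrite (integral_partial_eq0 (M := Num.max M N) D)//.
- exact: test_continuous (test_partial i tphi).
- by move=> x /HM; apply: cubeS; rewrite le_max lexx.
- by move=> x /HN; apply: cubeS; rewrite le_max lexx orbT.
Qed.

Lemma ibp_partial i phi psi : test_function Om phi -> smooth psi ->
  \int[mu]_(x in Om) (partial i phi x * psi x) =
  - \int[mu]_(x in Om) (phi x * partial i psi x).
Proof.
move=> tphi spsi; have := integral_test_partial i (test_mul tphi spsi).
rewrite partialM; [|by case: tphi => /smooth_partials|exact: smooth_partials].
rewrite RintegralD//.
- by move/eqP; rewrite addr_eq0 => /eqP.
- exact: test_integrableO (test_mul (test_partial i tphi) spsi).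
- exact: test_integrableO (test_mul tphi (smooth_partial i spsi)).
Qed.

(** Each integration by parts moves the outermost derivative, so that the
    derivatives arrive on the other factor in reverse order. *)
Lemma ibp_foldr s phi psi : test_function Om phi -> smooth psi ->
  \int[mu]_(x in Om) (foldr (@partial R n) phi s x * psi x) =
  (-1) ^+ size s *
  \int[mu]_(x in Om) (phi x * foldr (@partial R n) psi (rev s) x).
Proof.
move=> tphi; elim: s psi => [|i s IH] psi spsi; first by rewrite expr0 mul1r.
rewrite /= (ibp_partial i (test_foldr s tphi) spsi).
rewrite IH; last exact: smooth_partial.
by rewrite exprS mulN1r mulNr rev_cons foldr_rcons.
Qed.

Lemma integrable_loc_mul w f (K : set 'rV[R]_n) : loc_integrable Om w ->
  compact K -> K `<=` Om -> continuous f -> (forall x, f x != 0 -> K x) ->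
  mu.-integrable Om (EFin \o (fun x => w x * f x)).
Proof.
move=> [mw iw] cK KO cf fK; have mK := compact_measurable_rV cK.
have -> : EFin \o (fun x => w x * f x) = (EFin \o (fun x => w x * f x)) \_ K.
  apply/funext => x; rewrite patchE; case: ifPn => // /negP xK /=.
  have [->|/fK xK'] := eqVneq (f x) 0; first by rewrite mulr0.
  by exfalso; apply: xK; rewrite inE.
apply/integrable_restrict => //; rewrite setIidr//.
have [M _ HM] := compact_cube cK.
have [C _ HC] := continuous_bounded M cf.
apply: (integrable_mul_bounded (C := C)) => //; first exact: iw.
  exact: continuous_measurable_rV.
by move=> x /HM; exact: HC.
Qed.

Lemma integrable_loc_test w phi : loc_integrable Om w -> test_function Om phi ->
  mu.-integrable Om (EFin \o (fun x => w x * phi x)).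
Proof.
move=> lw tphi; have [_ cphi phiO] := tphi.
apply: (integrable_loc_mul lw cphi phiO); first exact: test_continuous tphi.
by move=> x phix; exact: subset_closure.
Qed.

Lemma loc_integrable_lin u w (t : R) : loc_integrable Om u -> loc_integrable Om w ->
  loc_integrable Om (fun x => u x + t * w x).
Proof.
move=> [mu_ iu] [mw iw]; split.
  by apply: measurable_funD => //; exact: measurable_funM.
move=> K cK KO; apply: integrable_lin; first exact: compact_measurable_rV.
  exact: iu.
exact: iw.
Qed.

(** Bumps converge boundedly to the indicator of every box inside Om, so w has
    integral zero over these boxes; intersections of a box with orthants are
    boxes again, and countably many boxes cover Om. *)
Lemma fundamental_lemma w : loc_integrable Om w ->
  (forall phi, test_function Om phi -> \int[mu]_(x in Om) (w x * phi x) = 0) ->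
  {ae mu, forall x, Om x -> w x = 0}.
Proof.
move=> lw w0; have [mw iw] := lw.
have box0 a b : cbox a b `<=` Om -> \int[mu]_(x in obox a b) w x = 0.
  move=> abO; have mab : measurable (cbox a b) by exact: measurable_cbox.
  have iab := iw _ (compact_cbox (a := a) (b := b)) abO.
  have mwab : measurable_fun (cbox a b) w by exact: measurable_funS mw.
  rewrite -[obox a b](setIidr (@obox_cbox _ _ a b)) Rintegral_mkcondr.
  suff H : \int[mu]_(x in cbox a b) (w x * bump a b k x) @[k --> \oo]
      --> \int[mu]_(x in cbox a b) (w \_ (obox a b)) x.
    rewrite -(cvg_lim (@Rhausdorff R) H); apply: lim_near_cst => //.
    apply: nearW => k; rewrite -[RHS](w0 _ (test_bump k abO)).
    rewrite -[cbox a b in LHS](setIidr abO) Rintegral_mkcondr.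
    apply: eq_Rintegral => x _; rewrite patchE; case: ifPn => // /negP xab.
    have [->|/bump_neq0 /obox_cbox] := eqVneq (bump a b k x) 0; first by rewrite mulr0.
    by move=> xab'; exfalso; apply: xab; rewrite inE.
  apply: (@Rdominated_cvg _ _ _ _ _ _ _ (fun x => `|w x|)) => //.
  - move=> k; apply: measurable_funM => //; apply: continuous_measurable_rV => //.
    by apply: smooth_continuous; exact: smooth_bump.
  - apply/measurable_restrict => //; first exact: measurable_obox.
    exact: measurable_funS mwab.
  - move=> x _; rewrite (_ : (w \_ (obox a b)) x = w x * \1_(obox a b) x).
      by apply: cvgMr; exact: cvg_bump.
    by rewrite patchE indicE; case: ifP => _; rewrite ?mulr1 ?mulr0.
  - exact: integrable_norm.
  - by move=> k x _; rewrite normrM ler_piMr// bump_le1.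
have obox0 a b : cbox a b `<=` Om -> {ae mu, forall x, obox a b x -> w x = 0}.
  move=> abO; have mab : measurable (obox a b) by exact: measurable_obox.
  apply: ae_eq0_orthant => //.
    apply: integrableS (iw _ (compact_cbox (a := a) (b := b)) abO) => //.
      exact: measurable_cbox.
    exact: obox_cbox.
  move=> c; pose c' : 'rV[R]_n := \row_i Num.min (b ord0 i) (c ord0 i).
  rewrite (_ : _ `&` _ = obox a c').
    apply: box0 => x xc; apply: abO => i; have := xc i; rewrite !in_itv/= mxE.
    by rewrite le_min => /andP[-> /andP[-> _]].
  apply/seteqP; split => x /=.
    by move=> [xab xc] i; rewrite mxE lt_min xc andbT.
  move=> h; split => i; have := h i; rewrite mxE lt_min.
    by move=> /andP[-> /andP[-> _]].
  by move=> /andP[_ /andP[]].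
pose B k := obox (rat_box R n k).1 (rat_box R n k).2.
pose inside k := cbox (rat_box R n k).1 (rat_box R n k).2 `<=` Om.
have : mu.-negligible (\bigcup_k [set x | inside k /\ B k x /\ w x <> 0]).
  apply: negligible_bigcup => k; have [kO|kO] := pselect (inside k).
    apply: negligibleS (obox0 _ _ kO) => x /= [_ [Bx wx]].
    by apply/not_implyP.
  by apply: negligibleS (negligible_set0 _) => x [].
apply: negligibleS => x /= /not_implyP[Ox wx0].
by have := Ox; rewrite {1}(open_bigcup_obox oOm) => -[k /= kO xk]; exists k.
Qed.

End test_functions.

(** * Weak derivatives *)

Section weak_derivatives.
Variables (R : realType) (n : nat) (Om : set 'rV[R]_n).
Hypothesis oOm : open Om.
Implicit Types (phi psi u v w z : 'rV[R]_n -> R) (a : 'I_n -> nat).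
Notation mu := (lebesgue_rV R n).
Notation Ds s f := (foldr (@partial R n) f s).

Let mOm : measurable Om := open_measurable_rV oOm.

(** Flattening a multi-index to the list of its single differentiations lets one
    induction on lists treat all derivatives. *)
Definition mseq a : seq 'I_n := flatten [seq nseq (a i) i | i <- enum 'I_n].

Lemma multiD_foldr a phi : multiD a phi = Ds (mseq a) phi.
Proof.
rewrite /multiD /mseq; elim: (enum _) => //= i s ->.
by rewrite foldr_cat; elim: (a i) => //= k ->.
Qed.

Lemma size_mseq a : size (mseq a) = (\sum_i a i)%N.
Proof.
rewrite size_flatten /shape -map_comp sumnE big_map big_enum.
by apply: eq_bigr => i _; rewrite /= size_nseq.
Qed.

Definition pure2 (i : 'I_n) : 'I_n -> nat := fun j => if j == i then 2%N else 0%N.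

Lemma sum_pure2 i : (\sum_j pure2 i j)%N = 2%N.
Proof. by rewrite /pure2 -big_mkcond/= big_pred1_eq. Qed.

Lemma mseq_pure2 i : mseq (pure2 i) = [:: i; i].
Proof.
have := size_mseq (pure2 i); rewrite sum_pure2.
have : all (pred1 i) (mseq (pure2 i)).
  apply/allP => j /flatten_mapP[k _]; rewrite mem_nseq /pure2.
  by have [->|//] := eqVneq k i; move=> /eqP ->; rewrite /= eqxx.
by move=> /all_pred1P E sz; rewrite E sz.
Qed.

Lemma mseq0 : mseq (fun=> 0%N) = [::].
Proof. by apply: size0nil; rewrite size_mseq big1. Qed.

Lemma is_weakD_lin a u v w z (t : R) :
  is_weakD Om a u w -> is_weakD Om a v z ->
  is_weakD Om a (fun x => u x + t * v x) (fun x => w x + t * z x).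
Proof.
move=> [lu lw uw] [lv lz vz]; split; [exact: loc_integrable_lin..|].
move=> phi tphi.
have tD : test_function Om (multiD a phi) by rewrite multiD_foldr; exact: test_foldr.
have expand u' v' f : loc_integrable Om u' -> loc_integrable Om v' ->
    test_function Om f ->
    \int[mu]_(x in Om) ((u' x + t * v' x) * f x) =
    \int[mu]_(x in Om) (u' x * f x) + t * \int[mu]_(x in Om) (v' x * f x).
  move=> lu' lv' tf.
  have iu := integrable_loc_test oOm lu' tf; have iv := integrable_loc_test oOm lv' tf.
  rewrite -Rintegral_lin//.
  by apply: eq_Rintegral => x _; rewrite mulrDl mulrA.
by rewrite !expand// uw// vz//; ring.
Qed.

(** The classical derivative in reverse order, which is the order that
    integration by parts produces. *)
Lemma is_weakD_test a phi : test_function Om phi ->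
  is_weakD Om a phi (Ds (rev (mseq a)) phi).
Proof.
move=> tphi; have tD := test_foldr (rev (mseq a)) tphi.
split; [exact: test_loc_integrable..|].
move=> psi [spsi _ _]; rewrite multiD_foldr -size_mseq.
by rewrite (ibp_foldr oOm _ tphi)// size_rev revK mulrA -expr2 sqrr_sign mul1r.
Qed.

Lemma is_weakD_unique a u w z : is_weakD Om a u w -> is_weakD Om a u z ->
  {ae mu, forall x, Om x -> w x = z x}.
Proof.
move=> [_ lw uw] [_ lz uz].
have lwz : loc_integrable Om (fun x => w x + (-1) * z x) by exact: loc_integrable_lin.
suff : {ae mu, forall x, Om x -> w x + (-1) * z x = 0}.
  apply: filterS => x h Ox; have := h Ox; rewrite mulN1r => /eqP.
  by rewrite subr_eq0 => /eqP.
apply: (fundamental_lemma oOm lwz) => phi tphi.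
have iw := integrable_loc_test oOm lw tphi; have iz := integrable_loc_test oOm lz tphi.
under eq_Rintegral do rewrite mulrDl mulN1r mulNr.
rewrite RintegralB//; apply/eqP; rewrite subr_eq0; apply/eqP.
have := uw phi tphi; rewrite uz// => /eqP; rewrite -subr_eq0 -mulrBr mulf_eq0.
by rewrite signr_eq0/= subr_eq0 => /eqP.
Qed.

Lemma is_weakD0 u : loc_integrable Om u -> is_weakD Om (fun=> 0%N) u u.
Proof.
move=> lu; split => // phi _.
by rewrite multiD_foldr mseq0/= big1// expr0 mul1r.
Qed.

(** The representative chosen by weakD is a weak derivative as soon as there is
    one; by uniqueness it then agrees almost everywhere with any other. *)
Lemma weakDP a u w : is_weakD Om a u w -> is_weakD Om a u (weakD Om a u).
Proof. by move=> uw; apply: (@getPex _ [set w | is_weakD Om a u w]); exists w. Qed.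

Lemma ae_weakD a u w : is_weakD Om a u w ->
  {ae mu, forall x, Om x -> weakD Om a u x = w x}.
Proof. by move=> uw; exact: is_weakD_unique (weakDP uw) uw. Qed.

Lemma is_weakD_measurable a u w : is_weakD Om a u w -> measurable_fun Om w.
Proof. by move=> [_ []]. Qed.

End weak_derivatives.

(** * The space L^G *)

Lemma ae_cong d (T : measurableType d) (R : realType)
    (mu : {measure set T -> \bar R}) (D : set T) (U V : T -> R) (h : R -> R) :
  {ae mu, forall x, D x -> U x = V x} ->
  {ae mu, forall x, D x -> h (U x) = h (V x)}.
Proof. by apply: filterS => x UV Dx; rewrite UV. Qed.

Lemma ae_Rintegral d (T : measurableType d) (R : realType)
    (mu : {measure set T -> \bar R}) (D : set T) (U V : T -> R) :
  measurable D -> measurable_fun D U -> measurable_fun D V ->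
  {ae mu, forall x, D x -> U x = V x} ->
  \int[mu]_(x in D) U x = \int[mu]_(x in D) V x.
Proof.
move=> mD mU mV UV; congr fine; apply: ae_eq_integral => //; try exact/measurable_EFinP.
by apply: filterS UV => x UVx Dx; rewrite UVx.
Qed.

Lemma le_integrable_norm d (T : measurableType d) (R : realType)
    (mu : {measure set T -> \bar R}) (D : set T) (f h : T -> R) :
  measurable D -> measurable_fun D f -> (forall x, D x -> `|f x| <= h x) ->
  mu.-integrable D (EFin \o h) -> mu.-integrable D (EFin \o f).
Proof.
move=> mD mf fh; apply: le_integrable => //; first exact/measurable_EFinP.
by move=> x Dx /=; rewrite lee_fin (le_trans (fh x Dx))// ler_norm.
Qed.

Section Orlicz.
Variables (R : realType) (n : nat) (Om : set 'rV[R]_n) (g G : R -> R) (pp : R).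
Hypotheses (oOm : open Om) (bOm : bounded_set Om) (NG : Nfunction g G).
Hypotheses (pp0 : 0 < pp) (gG : forall t, 0 < t -> t * g t <= pp * G t).
Implicit Types u v w f h : 'rV[R]_n -> R.
Notation mu := (lebesgue_rV R n).

Let mOm : measurable Om := open_measurable_rV oOm.

Lemma Nfun_scale_bound t : exists2 K, 0 <= K & forall s, G (t * s) <= K * G s.
Proof.
have [C C0 HC] := Nfun_Delta2 NG pp0 gG.
have HCk k s : G (2 ^+ k * s) <= C ^+ k * G s.
  elim: k => [|k IH]; first by rewrite !expr0 !mul1r.
  by rewrite !exprS -!mulrA (le_trans (HC _))// ler_wpM2l// ltW.
exists (C ^+ Num.bound `|t|) => [|s]; first by rewrite exprn_ge0// ltW.
apply: le_trans (HCk _ _).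
apply: (Nfun_G_le NG); rewrite !normrM ler_wpM2r// [leRHS]ger0_norm ?exprn_ge0//.
apply: le_trans (ltW (archi_boundP (normr_ge0 t))) _.
by rewrite -natrX ler_nat ltnW// ltn_expl.
Qed.

(** The bound that makes L^G a vector space: convexity at the midpoint of 2 a and
    2 t b, and the Delta_2 condition. *)
Lemma Nfun_lin_bound t : exists2 K, 0 <= K &
  forall a b, G (a + t * b) <= K * (G a + G b).
Proof.
have [K K0 HK] := Nfun_scale_bound 2; have [L L0 HL] := Nfun_scale_bound (2 * t).
exists (K + L) => [|a b]; first by rewrite addr_ge0.
have := @Nfun_G_convex _ _ _ NG 2^-1 (2 * a) (2 * t * b).
have -> : 2^-1 * (2 * a) + (1 - 2^-1) * (2 * t * b) = a + t * b by field.
have -> : 0 <= (2^-1 : R) <= 1 by lra.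
move=> /(_ isT); have := HK a; have := HL b.
have := Nfun_G_ge0 NG a; have := Nfun_G_ge0 NG b; nra.
Qed.

Lemma measurable_NfunG f : measurable_fun Om f -> measurable_fun Om (fun x => G (f x)).
Proof.
by apply: measurableT_comp; apply: continuous_measurable_fun; exact: Nfun_G_continuous NG.
Qed.

Lemma measurable_Nfung f : measurable_fun Om f -> measurable_fun Om (fun x => g (f x)).
Proof.
by apply: measurableT_comp; apply: continuous_measurable_fun; exact: Nfun_g_continuous NG.
Qed.

Lemma orliczP f : orlicz G Om f <->
  measurable_fun Om f /\ mu.-integrable Om (EFin \o (fun x => G (f x))).
Proof.
have E : (\int[mu]_(x in Om) `|G (f x)|%:E = modular G Om f)%E.
  by apply: eq_integral => x _; rewrite ger0_norm// (Nfun_G_ge0 NG).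
split=> -[mf Gf]; split => //.
  by apply/integrableP; split; [apply/measurable_EFinP; exact: measurable_NfunG|rewrite /= E].
by have /integrableP[_] := Gf; rewrite /= E.
Qed.

Lemma modularE f : orlicz G Om f ->
  modular G Om f = (\int[mu]_(x in Om) G (f x))%:E.
Proof. by move=> /orliczP[_ iG]; rewrite fineK//; exact: integrable_fin_num. Qed.

Lemma ae_modular f h : measurable_fun Om f -> measurable_fun Om h ->
  {ae mu, forall x, Om x -> f x = h x} -> modular G Om f = modular G Om h.
Proof.
move=> mf mh fh; apply: ae_eq_integral => //;
  try by apply/measurable_EFinP; exact: measurable_NfunG.
by apply: filterS fh => x fhx Omx; rewrite fhx.
Qed.

Lemma ae_orlicz f h : measurable_fun Om h ->
  {ae mu, forall x, Om x -> f x = h x} -> orlicz G Om f -> orlicz G Om h.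
Proof. by move=> mh fh [mf Gf]; split => //; rewrite -(ae_modular mf). Qed.

Lemma orlicz_lin f h (t : R) : orlicz G Om f -> orlicz G Om h ->
  orlicz G Om (fun x => f x + t * h x).
Proof.
move=> /orliczP[mf If] /orliczP[mh Ih]; apply/orliczP.
have m : measurable_fun Om (fun x => f x + t * h x).
  by apply: measurable_funD => //; exact: measurable_funM.
split => //; have [K K0 HK] := Nfun_lin_bound t.
apply: (@le_integrable_norm _ _ _ _ _ _ (fun x => K * (G (f x) + 1 * G (h x)))) => //.
- exact: measurable_NfunG.
- by move=> x _; rewrite ger0_norm ?(Nfun_G_ge0 NG)// mul1r.
- by apply: integrable_scale => //; exact: integrable_lin.
Qed.

Lemma Om_lty : (mu Om < +oo)%E.
Proof. exact: bounded_lty. Qed.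

Lemma integrable_cst_Om (c : R) : mu.-integrable Om (EFin \o (fun=> c)).
Proof.
apply: measurable_bounded_integrable => //; first exact: Om_lty.
exists `|c|; split; first exact: num_real.
by move=> D cD x _; exact: ltW.
Qed.

Lemma norm_le_Nfun t : `|t| <= 1 + (G 1)^-1 * G t.
Proof.
have G1 : 0 < G 1 by rewrite (Nfun_G_gt0 NG)// oner_eq0.
have Gt := Nfun_G_ge0 NG t.
have [t1|t1] := leP `|t| 1; first by rewrite (le_trans t1)// lerDl mulr_ge0// invr_ge0 ltW.
apply: (@le_trans _ _ ((G 1)^-1 * G t)); last by rewrite lerDr.
rewrite -(Nfun_G_norm NG t) ler_pdivlMl//.
have t0 : 0 < `|t| by rewrite (lt_trans _ t1).
have := @Nfun_G_convex _ _ _ NG `|t|^-1 `|t| 0.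
rewrite mulVf ?gt_eqF// !mulr0 addr0 (NfunG0 NG) mulr0 addr0.
rewrite invr_ge0 (ltW t0) invf_le1// (ltW t1) => /(_ isT).
by rewrite ler_pdivlMl// mulrC.
Qed.

Lemma orlicz_integrable f : orlicz G Om f -> mu.-integrable Om (EFin \o f).
Proof.
move=> /orliczP[mf If].
apply: (@le_integrable_norm _ _ _ _ _ _ (fun x => 1 + (G 1)^-1 * G (f x))) => //.
  by move=> x _; exact: norm_le_Nfun.
by apply: integrable_lin => //; exact: integrable_cst_Om.
Qed.

Definition L1bound : R := fine (mu Om) + (G 1)^-1.

(** An N-function dominates the absolute value up to an additive constant, which
    is integrable on a set of finite measure. *)
Lemma L1_le_modular f (l : R) : measurable_fun Om f -> 0 < l ->
  (modular G Om (fun x => f x / l)%R <= 1)%E ->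
  mu.-integrable Om (EFin \o f) /\ \int[mu]_(x in Om) `|f x| <= l * L1bound.
Proof.
move=> mf l0 m1.
have mfl : measurable_fun Om (fun x => f x / l) by exact: measurable_funM.
have ofl : orlicz G Om (fun x => f x / l).
  by split => //; rewrite (le_lt_trans m1)// ltry.
have ifl := orlicz_integrable ofl; have /orliczP[_ iG] := ofl.
have fE : f = fun x => l * (f x / l).
  by apply/funext => x; rewrite mulrC divfK// gt_eqF.
have If : mu.-integrable Om (EFin \o f) by rewrite fE; exact: integrable_scale.
split => //.
apply: (@le_trans _ _ (\int[mu]_(x in Om) (l * (1 + (G 1)^-1 * G (f x / l))))).
  apply: le_Rintegral => //; first exact: integrable_norm.
    by apply: integrable_scale => //; apply: integrable_lin => //; exact: integrable_cst_Om.
  move=> x _; rewrite -ler_pdivrMl//; apply: le_trans (norm_le_Nfun _).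
  by rewrite normrM normfV (gtr0_norm l0) mulrC.
have i1 := integrable_cst_Om 1.
rewrite RintegralZl//; last exact: integrable_lin.
rewrite Rintegral_lin// Rintegral_cst// mul1r ler_wpM2l ?(ltW l0)//.
rewrite lerD2l ler_piMr// ?invr_ge0 ?(Nfun_G_ge0 NG)//.
by rewrite -lee_fin -modularE.
Qed.

Lemma luxemburg_ge0 f : (0 <= luxemburg G Om f)%E.
Proof.
by apply/ereal_infP => _ [l [l0 _] <-]; rewrite lee_fin ltW.
Qed.

Lemma luxemburg_ltP f (e : R) : (luxemburg G Om f < e%:E)%E ->
  exists l, [/\ 0 < l, l < e & (modular G Om (fun x => f x / l)%R <= 1)%E].
Proof.
move=> /ereal_inf_lt[_ [l [l0 m1] <-]]; rewrite lte_fin => le.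
by exists l.
Qed.

(** With L = l + |t| m the quotient (f + t h) / L is a convex combination of f / l
    and +- h / m; the modular is convex and even. *)
Lemma luxemburg_lin f h k (t d : R) : 0 < d ->
  measurable_fun Om f -> measurable_fun Om h -> measurable_fun Om k ->
  {ae mu, forall x, Om x -> k x = f x + t * h x} ->
  (luxemburg G Om f < d%:E)%E -> (luxemburg G Om h < d%:E)%E ->
  (luxemburg G Om k <= ((1 + `|t|) * d)%:E)%E.
Proof.
move=> d0 mf mh mk kE /luxemburg_ltP[l [l0 ld fl]] /luxemburg_ltP[m [m0 md hm]].
pose L := l + `|t| * m.
have L0 : 0 < L by rewrite ltr_wpDr// mulr_ge0// ltW.
have Ln : L != 0 by rewrite gt_eqF.
have Ld : L <= (1 + `|t|) * d.
  by rewrite /L mulrDl mul1r lerD ?(ltW ld)// ler_wpM2l// ltW.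
apply: (@le_trans _ _ L%:E); last by rewrite lee_fin.
apply: ge_ereal_inf; exists L%:E => //; exists L => //; split => //.
have mS (c : R) u : measurable_fun Om u -> measurable_fun Om (fun x => u x / c).
  by move=> mu'; exact: measurable_funM.
have mft : measurable_fun Om (fun x => f x + t * h x).
  by apply: measurable_funD => //; exact: measurable_funM.
rewrite (@ae_modular _ (fun x => (f x + t * h x) / L)); [|exact: mS..|]; last first.
  exact: (ae_cong (fun y => y / L)).
have of_ : orlicz G Om (fun x => f x / l).
  by split; [exact: mS|rewrite (le_lt_trans fl)// ltry].
have oh : orlicz G Om (fun x => h x / m).
  by split; [exact: mS|rewrite (le_lt_trans hm)// ltry].
pose a := l / L.
have a01 : 0 <= a <= 1.
  rewrite /a divr_ge0 ?(ltW l0) ?(ltW L0)//= ler_pdivrMr// mul1r /L lerDl.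
  by rewrite mulr_ge0// ltW.
have aE : 1 - a = `|t| * m / L by rewrite /a /L; field; rewrite gt_eqF.
have bound x : G ((f x + t * h x) / L) <= a * G (f x / l) + (1 - a) * G (h x / m).
  have -> : (f x + t * h x) / L = a * (f x / l) + (1 - a) * (Num.sg t * (h x / m)).
    rewrite aE /a {1}[t]numEsg; field; by rewrite Ln gt_eqF//= gt_eqF.
  apply: le_trans (Nfun_G_convex NG _ _ a01) _; rewrite lerD2l.
  have /andP[_ a1] := a01; rewrite ler_wpM2l ?subr_ge0//.
  apply: (Nfun_G_le NG); rewrite normrM ler_piMl//.
  by case: sgrP; rewrite ?normr0 ?normr1// normrN1.
have [_ iF] := (orliczP _).1 of_; have [_ iH] := (orliczP _).1 oh.
have oft : orlicz G Om (fun x => (f x + t * h x) / L).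
  apply/orliczP; split; first exact: mS.
  apply: (@le_integrable_norm _ _ _ _ _ _
    (fun x => a * G (f x / l) + (1 - a) * G (h x / m))) => //.
  - by apply: measurable_NfunG; exact: mS.
  - by move=> x _; rewrite ger0_norm ?(Nfun_G_ge0 NG).
  - by apply: integrable_lin => //; exact: integrable_scale.
have [_ iL] := (orliczP _).1 oft.
rewrite modularE// lee_fin.
apply: (@le_trans _ _ (\int[mu]_(x in Om) (a * G (f x / l) + (1 - a) * G (h x / m)))).
  apply: le_Rintegral => //.
  by apply: integrable_lin => //; exact: integrable_scale.
rewrite Rintegral_lin//; last exact: integrable_scale.
rewrite RintegralZl//.
have f1 : \int[mu]_(x in Om) G (f x / l) <= 1 by rewrite -lee_fin -modularE.
have h1 : \int[mu]_(x in Om) G (h x / m) <= 1 by rewrite -lee_fin -modularE.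
have /andP[a0 a1] := a01; nra.
Qed.

End Orlicz.

(** * The spaces W^{2,G} and W^{2,G}_0 *)

Section Sobolev.
Variables (R : realType) (n : nat) (Om : set 'rV[R]_n) (g G : R -> R) (pp : R).
Hypotheses (oOm : open Om) (bOm : bounded_set Om) (NG : Nfunction g G).
Hypotheses (pp0 : 0 < pp) (gG : forall t, 0 < t -> t * g t <= pp * G t).
Implicit Types (u v w f h : 'rV[R]_n -> R) (a : 'I_n -> nat).
Notation mu := (lebesgue_rV R n).
Notation lap := (laplacian Om).

Let mOm : measurable Om := open_measurable_rV oOm.

Lemma W2G_weakD u a : W2G G Om u -> (\sum_i a i <= 2)%N ->
  is_weakD Om a u (weakD Om a u) /\ orlicz G Om (weakD Om a u).
Proof.
move=> Wu a2; have [w ow uw] := Wu a a2; have wd := weakDP uw.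
split => //; apply: (ae_orlicz oOm NG (is_weakD_measurable wd) _ ow).
by apply: filterS (ae_weakD oOm uw) => x h /h.
Qed.

Lemma W2G_loc u : W2G G Om u -> loc_integrable Om u.
Proof.
move=> Wu; have [|[]//] := @W2G_weakD u (fun=> 0%N) Wu.
by rewrite big1.
Qed.

Lemma W2G_orlicz u : W2G G Om u -> orlicz G Om u.
Proof.
move=> Wu; have lu := W2G_loc Wu; have [|_ ow] := @W2G_weakD u (fun=> 0%N) Wu.
  by rewrite big1.
apply: (ae_orlicz oOm NG _ _ ow); first by case: lu.
exact: (ae_weakD oOm (is_weakD0 lu)).
Qed.

Lemma W2G_pure2 u i : W2G G Om u ->
  is_weakD Om (pure2 i) u (weakD Om (pure2 i) u) /\ orlicz G Om (weakD Om (pure2 i) u).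
Proof. by move=> Wu; apply: W2G_weakD => //; rewrite sum_pure2. Qed.

Lemma orlicz0 : orlicz G Om (fun=> 0).
Proof.
split; first exact: measurable_cst.
by rewrite /modular (NfunG0 NG) integral0 ltry.
Qed.

Lemma laplacianE u x : lap u x = \sum_(i < n) weakD Om (pure2 i) u x.
Proof. by []. Qed.

Lemma laplacian_orlicz u : W2G G Om u -> orlicz G Om (lap u).
Proof.
move=> Wu; have -> : lap u = fun x => \sum_(i < n) weakD Om (pure2 i) u x by [].
elim: (index_enum _) => [|i s IH].
  rewrite (_ : (fun _ => _) = fun=> 0); first exact: orlicz0.
  by apply/funext => x; rewrite big_nil.
rewrite (_ : (fun _ => _) =
    fun x => weakD Om (pure2 i) u x + 1 * \sum_(j <- s) weakD Om (pure2 j) u x).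
  by apply: (orlicz_lin oOm NG pp0 gG) => //; case: (W2G_pure2 i Wu).
by apply/funext => x; rewrite big_cons mul1r.
Qed.

Lemma W2G_lin u v (t : R) : W2G G Om u -> W2G G Om v ->
  W2G G Om (fun x => u x + t * v x).
Proof.
move=> Wu Wv a a2; have [w ow uw] := Wu a a2; have [z oz vz] := Wv a a2.
exists (fun x => w x + t * z x); first exact: (orlicz_lin oOm NG pp0 gG).
exact: is_weakD_lin.
Qed.

Lemma laplacian_lin u v (t : R) : W2G G Om u -> W2G G Om v ->
  {ae mu, forall x, Om x -> lap (fun y => u y + t * v y) x = lap u x + t * lap v x}.
Proof.
move=> Wu Wv.
have H i : {ae mu, forall x, Om x -> weakD Om (pure2 i) (fun y => u y + t * v y) x =
    weakD Om (pure2 i) u x + t * weakD Om (pure2 i) v x}.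
  apply: ae_weakD => //; apply: is_weakD_lin => //.
    by have [] := W2G_pure2 i Wu.
  by have [] := W2G_pure2 i Wv.
have : {ae mu, forall x, forall i, Om x ->
    weakD Om (pure2 i) (fun y => u y + t * v y) x =
    weakD Om (pure2 i) u x + t * weakD Om (pure2 i) v x}.
  exact: filter_forall.
apply: filterS => x Hx Ox; rewrite !laplacianE mulr_sumr -big_split/=.
by apply: eq_bigr => i _; exact: Hx.
Qed.

Lemma is_weakD_sub_test u w a phi : is_weakD Om a u w -> test_function Om phi ->
  is_weakD Om a (u \- phi)
    (fun x => w x + (-1) * foldr (@partial R n) phi (rev (mseq a)) x).
Proof.
move=> uw tphi; have := is_weakD_lin oOm (-1) uw (is_weakD_test oOm a tphi).
by congr is_weakD; apply/funext => x; rewrite mulN1r.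
Qed.

Lemma W2G_norm_term w (e : R) a : (forall i, a i <= 2)%N -> (\sum_i a i <= 2)%N ->
  (W2G_norm G Om w < e%:E)%E -> (luxemburg G Om (weakD Om a w) < e%:E)%E.
Proof.
move=> ai a2; apply: le_lt_trans; rewrite /W2G_norm.
pose b : {ffun 'I_n -> 'I_3} := [ffun i => inord (a i)].
have bE : (fun i => b i : nat) = a.
  by apply/funext => i; rewrite ffunE inordK// ltnS.
rewrite (bigD1 b)/=; last by under eq_bigr do rewrite ffunE inordK ?ltnS//.
rewrite bE leeDl// sume_ge0// => c _; exact: luxemburg_ge0.
Qed.

(** The approximations of u and v combine, and each of the finitely many
    seminorms that make up the norm is subadditive. *)
Lemma W2G0_lin u v (t : R) : W2G0 G Om u -> W2G0 G Om v ->
  W2G0 G Om (fun x => u x + t * v x).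
Proof.
move=> [Wu au] [Wv av]; split; first exact: W2G_lin.
move=> e e0; pose N := #|{ffun 'I_n -> 'I_3}|.
(* the precision d leaves room for at most N seminorms, each below (1 + |t|) d *)
have t1 : 0 < 1 + `|t| by rewrite ltr_pwDl.
pose d := e / (N.+1%:R * (1 + `|t|)).
have d0 : 0 < d by rewrite divr_gt0// mulr_gt0.
have [phi tphi uphi] := au d d0; have [psi tpsi vpsi] := av d d0.
exists (fun x => phi x + t * psi x); first exact: test_lin.
apply: (@le_lt_trans _ _
    (\sum_(b : {ffun 'I_n -> 'I_3} | (\sum_i b i <= 2)%N) ((1 + `|t|) * d)%:E)%E).
  apply: lee_sum => b b2; pose a : 'I_n -> nat := fun i => b i.
  have a2 : (forall i, a i <= 2)%N by move=> i; rewrite -ltnS ltn_ord.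
  have [uw _] := W2G_weakD Wu b2; have [vw _] := W2G_weakD Wv b2.
  have u1 := is_weakD_sub_test uw tphi; have v1 := is_weakD_sub_test vw tpsi.
  have wu := weakDP u1; have wv := weakDP v1.
  have uv := is_weakD_lin oOm t wu wv.
  have E : (fun x => u x + t * v x) \- (fun x => phi x + t * psi x) =
      (fun x => (u \- phi) x + t * (v \- psi) x).
    by apply/funext => x /=; ring.
  rewrite E.
  apply: (luxemburg_lin oOm NG d0
    (is_weakD_measurable wu) (is_weakD_measurable wv)) => //.
  - exact: is_weakD_measurable (weakDP uv).
  - exact: ae_weakD.
  - exact: W2G_norm_term.
  - exact: W2G_norm_term.
rewrite sumEFin lte_fin sumr_const -mulr_natl.
have cN : (#|[pred b : {ffun 'I_n -> 'I_3} | (\sum_i b i <= 2)%N]| <= N)%N.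
  exact: max_card.
apply: (@le_lt_trans _ _ (N%:R * ((1 + `|t|) * d))).
  by rewrite ler_wpM2r ?ler_nat// mulr_ge0// ltW.
have -> : N%:R * ((1 + `|t|) * d) = e * (N%:R / N.+1%:R).
  rewrite /d -natr1; field.
  by rewrite gt_eqF//= natr1 gt_eqF.
by rewrite gtr_pMr// ltr_pdivrMr// mul1r ltr_nat.
Qed.

(** Functions of W^{2,G}_0 have no boundary values: second derivatives can be
    integrated by parts against smooth functions that do not vanish near the
    boundary of Om. *)
Lemma W2G0_ibp u psi i : W2G0 G Om u -> smooth psi ->
  \int[mu]_(x in Om) (weakD Om (pure2 i) u x * psi x) =
  \int[mu]_(x in Om) (u x * partial i (partial i psi) x).
Proof.
move=> [Wu au] spsi.
have [M _ OM] := bounded_cube bOm.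
have [A A0 HA] := continuous_bounded M (smooth_continuous spsi).
have sdd : smooth (partial i (partial i psi)) by do 2 apply: smooth_partial.
have [B B0 HB] := continuous_bounded M (smooth_continuous sdd).
have [uw ow] := W2G_pure2 i Wu; have iw := orlicz_integrable oOm bOm NG ow.
have iu := orlicz_integrable oOm bOm NG (W2G_orlicz Wu).
have mpsi : measurable_fun Om psi.
  by apply: continuous_measurable_rV => //; exact: smooth_continuous.
have mdd : measurable_fun Om (partial i (partial i psi)).
  by apply: continuous_measurable_rV => //; exact: smooth_continuous.
have ib f : mu.-integrable Om (EFin \o f) ->
    mu.-integrable Om (EFin \o (fun x => f x * psi x)).
  by move=> fi; apply: (integrable_mul_bounded (C := A)) => // x /OM /HA.
have ibb f : mu.-integrable Om (EFin \o f) ->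
    mu.-integrable Om (EFin \o (fun x => f x * partial i (partial i psi) x)).
  by move=> fi; apply: (integrable_mul_bounded (C := B)) => // x /OM /HB.
apply/eqP; rewrite -subr_eq0 -normr_le0; apply/ler_addgt0Pl => e e0; rewrite addr0.
pose K := (A + B) * L1bound Om G + 1.
have L0 : 0 <= L1bound Om G.
  by rewrite addr_ge0 ?fine_ge0// invr_ge0 (Nfun_G_ge0 NG).
have K0 : 0 < K by rewrite ltr_wpDl// mulr_ge0// ltW// addr_gt0.
have d0 : 0 < e / K by rewrite divr_gt0.
have [phi tphi nphi] := au _ d0.
have u0 := is_weakD_sub_test (is_weakD0 (W2G_loc Wu)) tphi.
have u2 := is_weakD_sub_test uw tphi.
rewrite mseq0/= in u0; rewrite mseq_pure2/= in u2.
have p0 : 'I_n -> (0 <= 2)%N by [].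
have s0 : (\sum_(j < n) 0 <= 2)%N by rewrite big1.
have [l [l0 ld lm]] := luxemburg_ltP (W2G_norm_term (a := fun=> 0%N) p0 s0 nphi).
have p2 j : (pure2 i j <= 2)%N by rewrite /pure2; case: ifP.
have s2 : (\sum_j pure2 i j <= 2)%N by rewrite sum_pure2.
have [k [k0 kd km]] := luxemburg_ltP (W2G_norm_term p2 s2 nphi).
have w0 := weakDP u0; have w2 := weakDP u2.
have [i0 b0] := L1_le_modular oOm bOm NG (is_weakD_measurable w0) l0 lm.
have [i2 b2] := L1_le_modular oOm bOm NG (is_weakD_measurable w2) k0 km.
have a0 := ae_weakD oOm u0; have a2 := ae_weakD oOm u2.
(* z0 and z2 are small in L^1, and phi itself integrates by parts exactly *)
set z0 := weakD Om (fun=> 0%N) (u \- phi) in w0 i0 b0 a0.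
set z2 := weakD Om (pure2 i) (u \- phi) in w2 i2 b2 a2.
have tD := test_partial i (test_partial i tphi).
have iphi := test_integrableO oOm tphi; have iD := test_integrableO oOm tD.
have mI f : mu.-integrable Om (EFin \o f) -> measurable_fun Om f.
  by move=> /integrableP[/measurable_EFinP].
have E0 : \int[mu]_(x in Om) (z0 x * partial i (partial i psi) x) =
    \int[mu]_(x in Om) (u x * partial i (partial i psi) x) -
    \int[mu]_(x in Om) (phi x * partial i (partial i psi) x).
  rewrite -RintegralB; [|by []|exact: ibb..]; apply: ae_Rintegral => //.
  - by apply: measurable_funM => //; exact: mI.
  - exact: measurable_funB (measurable_funM (mI _ iu) mdd) (measurable_funM (mI _ iphi) mdd).
  - by apply: filterS a0 => x h Ox; rewrite (h Ox); ring.
have E2 : \int[mu]_(x in Om) (z2 x * psi x) =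
    \int[mu]_(x in Om) (weakD Om (pure2 i) u x * psi x) -
    \int[mu]_(x in Om) (partial i (partial i phi) x * psi x).
  rewrite -RintegralB; [|by []|exact: ib..]; apply: ae_Rintegral => //.
  - by apply: measurable_funM => //; exact: mI.
  - exact: measurable_funB (measurable_funM (mI _ iw) mpsi) (measurable_funM (mI _ iD) mpsi).
  - by apply: filterS a2 => x h Ox; rewrite (h Ox); ring.
have Ep : \int[mu]_(x in Om) (partial i (partial i phi) x * psi x) =
    \int[mu]_(x in Om) (phi x * partial i (partial i psi) x).
  have := ibp_foldr oOm [:: i; i] tphi spsi.
  by rewrite /= expr2 mulN1r opprK mul1r.
have -> : \int[mu]_(x in Om) (weakD Om (pure2 i) u x * psi x) -
    \int[mu]_(x in Om) (u x * partial i (partial i psi) x) =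
    \int[mu]_(x in Om) (z2 x * psi x) -
    \int[mu]_(x in Om) (z0 x * partial i (partial i psi) x).
  by rewrite E0 E2 Ep; ring.
have bound f h C : 0 < C -> mu.-integrable Om (EFin \o f) ->
    mu.-integrable Om (EFin \o (fun x => f x * h x)) ->
    (forall x, Om x -> `|h x| <= C) ->
    `|\int[mu]_(x in Om) (f x * h x)| <= C * \int[mu]_(x in Om) `|f x|.
  move=> C0 fi fh hC; apply: le_trans (le_normr_Rintegral mOm fh) _.
  rewrite -RintegralZl//; last exact: integrable_norm.
  apply: le_Rintegral => //; first exact: integrable_norm.
    by apply: integrable_scale => //; exact: integrable_norm.
  by move=> x Ox; rewrite normrM mulrC ler_wpM2r// hC.
apply: le_trans (ler_normB _ _) _.
have B2 := bound z2 psi A A0 i2 (ib _ i2) (fun x Ox => HA x (OM x Ox)).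
have B1 := bound z0 _ B B0 i0 (ibb _ i0) (fun x Ox => HB x (OM x Ox)).
apply: (@le_trans _ _ (A * (e / K * L1bound Om G) + B * (e / K * L1bound Om G))).
  apply: lerD.
    apply: le_trans B2 _; rewrite ler_wpM2l ?(ltW A0)//; apply: le_trans b2 _.
    by rewrite ler_wpM2r ?(ltW kd).
  apply: le_trans B1 _; rewrite ler_wpM2l ?(ltW B0)//; apply: le_trans b0 _.
  by rewrite ler_wpM2r ?(ltW ld).
set L := L1bound Om G; have -> : A * (e / K * L) + B * (e / K * L) =
    e * ((A + B) * L / K) by ring.
by rewrite ler_piMr ?(ltW e0)// ler_pdivrMr// mul1r /K lerDl.
Qed.

End Sobolev.

(** * Uniqueness for the Dirichlet problem in W^{2,G}_0 *)

Lemma Rintegral_sum d (T : measurableType d) (R : realType)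
    (mu : {measure set T -> \bar R}) (D : set T) (I : Type) (s : seq I)
    (F : I -> T -> R) : measurable D ->
  (forall i, mu.-integrable D (EFin \o F i)) ->
  mu.-integrable D (EFin \o (fun x => \sum_(i <- s) F i x)) /\
  \int[mu]_(x in D) (\sum_(i <- s) F i x) = \sum_(i <- s) \int[mu]_(x in D) F i x.
Proof.
move=> mD iF; elim: s => [|i s [IH1 IH2]].
  rewrite big_nil (_ : (fun x => \sum_(i <- [::]) F i x) = fun=> 0).
    by split; [exact: integrable0|rewrite Rintegral_cst// mul0r].
  by apply/funext => x; rewrite big_nil.
rewrite (_ : (fun x => \sum_(j <- i :: s) F j x) =
    fun x => F i x + 1 * \sum_(j <- s) F j x); last first.
  by apply/funext => x; rewrite big_cons mul1r.
split; first exact: integrable_lin.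
by rewrite Rintegral_lin// IH2 big_cons mul1r.
Qed.

Section threshold.
Variable R : realType.
Implicit Types y z : R.

(* With w the square root of z, k w^k is bounded by Bernoulli's inequality and
   the remaining factor w^k tends to 0. *)
Let cvg_natM_expr z : 0 <= z < 1 -> k%:R * z ^+ k @[k --> \oo] --> (0 : R).
Proof.
move=> /andP[z0 z1]; pose w := Num.sqrt z.
have w1 : `|w| < 1 by rewrite ger0_norm ?sqrtr_ge0// -sqrtr1 ltr_sqrt.
have [zE|zn0] := eqVneq z 0.
  apply: cvg_near_cst; apply: nearW => k; rewrite zE.
  by case: k => [|k]; rewrite ?mul0r// exprS mul0r mulr0.
have w0 : 0 < w by rewrite sqrtr_gt0 lt_neqAle eq_sym zn0.
have w1' : w < 1 by rewrite -(gtr0_norm w0).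
pose C := (w^-1 - 1)^-1.
have C0 : 0 < w^-1 - 1 by rewrite subr_gt0 invf_gt1.
have kw k : k%:R * w ^+ k <= C.
  have := @le_Bernoulli R (w^-1 - 1) k; rewrite [1 + (w^-1 - 1)]addrC subrK.
  have -> : -1 <= w^-1 - 1 by rewrite lerBrDl subrr invr_ge0 ltW.
  move=> /(_ isT) h; rewrite -ler_pdivlMr ?exprn_gt0// -exprVn /C.
  rewrite mulrC -ler_pdivrMr ?invr_gt0// invrK; apply: le_trans h.
  by rewrite lerDr.
have wk : (C * w ^+ k) @[k --> \oo] --> (0 : R).
  by rewrite -(mulr0 C); apply: cvgMr; exact: cvg_expr.
apply: (@squeeze_cvgr _ _ _ _ (cst 0) (fun k => C * w ^+ k)) => //; last exact: cvg_cst.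
apply: nearW => k; rewrite mulr_ge0 ?exprn_ge0//=.
have -> : z ^+ k = w ^+ k * w ^+ k by rewrite -exprMn -expr2 sqr_sqrtr.
by rewrite mulrA ler_wpM2r// exprn_ge0// ltW.
Qed.

(** Polynomials in y that separate y < 1/2 from y >= 1/2 on [0, 1]; the factor k
    in the exponent is what makes the limit vanish at the threshold itself. *)
Lemma cvg_threshold y : 0 <= y <= 1 ->
  (1 - y ^+ k) ^+ (k * 2 ^ k) @[k --> \oo] --> ((y < 2^-1)%R%:R : R).
Proof.
move=> /andP[y0 y1].
have yk k : 0 <= y ^+ k <= 1 by rewrite exprn_ge0//= exprn_ile1.
have f01 k : 0 <= 1 - y ^+ k <= 1.
  by have /andP[? ?] := yk k; rewrite subr_ge0; apply/andP; split => //; lra.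
have [y2|y2] := ltP y 2^-1.
- have lim1 : 1 - k%:R * (2 * y) ^+ k @[k --> \oo] --> (1 : R).
    rewrite -[X in _ --> X]subr0; apply: cvgB; first exact: cvg_cst.
    by apply: cvg_natM_expr; apply/andP; split; lra.
  apply: (@squeeze_cvgr _ _ _ _ (fun k => 1 - k%:R * (2 * y) ^+ k) (cst 1)) => //;
    last exact: cvg_cst.
  apply: nearW => k; have /andP[? ?] := f01 k; rewrite exprn_ile1// andbT.
  have := @le_Bernoulli R (- y ^+ k) (k * 2 ^ k); rewrite lerN2.
  have /andP[_ ->] := yk k; move=> /(_ isT); apply: le_trans.
  by rewrite mulrN natrM natrX exprMn mulrA.
- have lim0 : expR (- k%:R) @[k --> \oo] --> (0 : R) by exact: cvgn_expR.
  apply: (@squeeze_cvgr _ _ _ _ (cst 0) (fun k => expR (- k%:R))) => //;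
    last exact: cvg_cst.
  apply: nearW => k; have /andP[? ?] := f01 k; rewrite exprn_ge0//=.
  apply: (@le_trans _ _ (expR (- (2^-1) ^+ k) ^+ (k * 2 ^ k))).
    apply: lerXn2r; rewrite ?nnegrE ?expR_ge0//.
    apply: le_trans (expR_ge1Dx _); rewrite lerD2l lerN2.
    by apply: lerXn2r; rewrite ?nnegrE// invr_ge0.
  rewrite -expRM_natl ler_expR natrM natrX mulrN lerN2 -mulrA -exprMn.
  by rewrite divff// expr1n mulr1.
Qed.

End threshold.

Section exponentials.
Variables (R : realType) (n : nat) (Om : set 'rV[R]_n) (h : 'rV[R]_n -> R).
Hypotheses (oOm : open Om) (bOm : bounded_set Om).
Notation mu := (lebesgue_rV R n).
Hypothesis ih : mu.-integrable Om (EFin \o h).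
Hypothesis h0 : forall xi : 'rV[R]_n, (forall i, 0 <= xi ord0 i) ->
  \int[mu]_(x in Om) (h x * expdot xi x) = 0.

Let mOm : measurable Om := open_measurable_rV oOm.

Let factors (s : seq (R * 'rV[R]_n)) (x : 'rV[R]_n) : R :=
  \prod_(p <- s) (1 - p.1 * expdot p.2 x).

Let smooth_factors s : smooth (factors s).
Proof.
apply: smooth_prod => p.
rewrite (_ : (fun x => _) = fun x => 1 + (- p.1) * expdot p.2 x); last first.
  by apply/funext => x; rewrite mulNr.
apply: smoothD; first exact: smooth_cst.
by apply: smoothM; [exact: smooth_cst|exact: smooth_expdot].
Qed.

Let integrable_hM (f : 'rV[R]_n -> R) : continuous f ->
  mu.-integrable Om (EFin \o (fun x => h x * f x)).
Proof.
move=> cf; have [M _ OM] := bounded_cube bOm.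
have [C _ HC] := continuous_bounded M cf.
apply: (integrable_mul_bounded (C := C)) => //; first exact: continuous_measurable_rV.
by move=> x /OM; exact: HC.
Qed.

(* Expanding one factor only shifts the exponent by a nonnegative vector. *)
Let factors0 (s : seq (R * 'rV[R]_n)) (xi : 'rV[R]_n) :
  (forall p, p \in s -> forall i, 0 <= p.2 ord0 i) -> (forall i, 0 <= xi ord0 i) ->
  \int[mu]_(x in Om) (h x * (factors s x * expdot xi x)) = 0.
Proof.
elim: s xi => [|p s IH] xi sp xi0.
  rewrite -[RHS](h0 xi0); apply: eq_Rintegral => x _.
  by rewrite /factors big_nil mul1r.
have sp' q : q \in s -> forall i, 0 <= q.2 ord0 i.
  by move=> qs; apply: sp; rewrite in_cons qs orbT.
have p0 i : 0 <= (p.2 + xi) ord0 i by rewrite mxE addr_ge0// sp// mem_head.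
have c (eta : 'rV[R]_n) : continuous (fun x => factors s x * expdot eta x).
  by apply: smooth_continuous; apply: smoothM => //; exact: smooth_expdot.
have := Rintegral_lin (- p.1) mOm (integrable_hM (c xi)) (integrable_hM (c (p.2 + xi))).
rewrite IH// IH// mulr0 addr0 => <-; apply: eq_Rintegral => x _.
by rewrite /factors big_cons expdotD; ring.
Qed.

(** Powers of exp(kappa (x_i - c_i)) / 2 threshold the coordinates of x at c, so
    the integrals of h against exponentials determine those over orthants. *)
Lemma ae_eq0_exponentials : {ae mu, forall x, Om x -> h x = 0}.
Proof.
apply: ae_eq0_orthant => // c.
have [M M0 OM] := bounded_cube bOm.
pose kappa i : R := ln 2 / (`|M - c ord0 i| + 1).
have ln2 : 0 < ln 2 :> R by rewrite ln_gt0// ltr1n.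
have kappa0 i : 0 < kappa i by rewrite divr_gt0// ltr_wpDl.
pose y i (x : 'rV[R]_n) : R := expR (kappa i * (x ord0 i - c ord0 i)) / 2.
have y01 i x : Om x -> 0 <= y i x <= 1.
  move=> /OM /cubeP Hx; rewrite /y divr_ge0 ?expR_ge0//= ler_pdivrMr// mul1r.
  rewrite -[leRHS](@lnK R)// ?posrE// ler_expR /kappa mulrAC ler_pdivrMr ?ltr_wpDl//.
  rewrite ler_wpM2l ?(ltW ln2)//.
  have xM : x ord0 i <= M by apply: le_trans (ler_norm _) (Hx i).
  by have := ler_norm (M - c ord0 i); lra.
pose f k x := \prod_(i <- index_enum 'I_n) (1 - y i x ^+ k) ^+ (k * 2 ^ k).
pose fac k i : R * 'rV[R]_n :=
  (expR (- (k%:R * (kappa i * c ord0 i))) / 2 ^+ k, (k%:R * kappa i) *: delta_mx ord0 i).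
have facE k i x : (fac k i).1 * expdot (fac k i).2 x = y i x ^+ k.
  rewrite /= /expdot /y exprMn exprVn mulrAC -expRD -expRM_natl; congr (expR _ / _).
  rewrite (bigD1 i)//= big1 => [|j /negbTE ji]; last first.
    by rewrite !mxE ji andbF mulr0 mul0r.
  by rewrite !mxE !eqxx/=; ring.
have fE k : f k = factors (flatten [seq nseq (k * 2 ^ k) (fac k i) | i <- index_enum 'I_n]).
  apply/funext => x; rewrite /factors big_flatten big_map; apply: eq_bigr => i _.
  by rewrite big_nseq facE iter_mulr_1.
have cf k : continuous (f k) by rewrite fE; exact: smooth_continuous.
have f0 k : \int[mu]_(x in Om) (h x * f k x) = 0.
  have := @factors0 (flatten [seq nseq (k * 2 ^ k) (fac k i) | i <- index_enum 'I_n]) 0.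
  rewrite -fE => H; rewrite -[RHS]H.
  - apply: eq_Rintegral => x _; rewrite /expdot big1 ?expR0 ?mulr1// => i _.
    by rewrite mxE mul0r.
  - move=> p /flatten_mapP[i _]; rewrite mem_nseq => /andP[_ /eqP ->] j.
    by rewrite /= !mxE !mulr_ge0// ltW.
  - by move=> i; rewrite mxE.
rewrite Rintegral_mkcondr.
suff H : \int[mu]_(x in Om) (h x * f k x) @[k --> \oo] -->
    \int[mu]_(x in Om) (h \_ (orthant c)) x.
  by rewrite -(cvg_lim (@Rhausdorff R) H); apply: lim_near_cst => //; exact: nearW.
have /integrableP[/measurable_EFinP mh _] := ih.
apply: (@Rdominated_cvg _ _ _ _ _ _ _ (fun x => `|h x|)) => //.
- move=> k; apply: measurable_funM => //; exact: continuous_measurable_rV.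
- apply/measurable_restrict => //; first exact: measurable_orthant.
  exact: measurable_funS mh.
- move=> x Ox; rewrite (_ : (h \_ (orthant c)) x =
      h x * \prod_(i <- index_enum 'I_n) (y i x < 2^-1)%R%:R).
    by apply: cvgMr; apply: cvg_bigprod => i; apply: cvg_threshold; exact: y01.
  have yE i : (y i x < 2^-1) = (x ord0 i < c ord0 i).
    rewrite /y -[X in _ < X]mul1r ltr_pM2r ?invr_gt0// expR_lt1 pmulr_rlt0//.
    by rewrite subr_lt0.
  rewrite patchE; case: ifPn => [|/negP] xc.
    rewrite big1 ?mulr1// => i _; rewrite yE.
    by move: xc; rewrite inE => /(_ i) ->.
  have [i xi] : exists i, ~~ (x ord0 i < c ord0 i).
    apply: contrapT => H; apply: xc; rewrite inE => i.
    by apply: contrapT => /negP xi; apply: H; exists i.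
  by rewrite (bigD1_seq i) ?mem_index_enum ?index_enum_uniq//= yE (negbTE xi) mul0r mulr0.
- exact: integrable_norm.
- move=> k x Ox; rewrite normrM ler_piMr// /f.
  elim/big_rec : _ => [|i z _ z1]; first by rewrite normr1.
  rewrite normrM -[leRHS]mulr1 ler_pM// normrX exprn_ile1//.
  have /andP[y0 y1] := y01 i x Ox.
  by rewrite ger0_norm ?subr_ge0 ?exprn_ile1// lerBlDr lerDl exprn_ge0.
Qed.

End exponentials.

Section uniqueness.
Variables (R : realType) (n : nat) (Om : set 'rV[R]_n) (g G : R -> R) (pp : R).
Hypotheses (n_gt0 : (0 < n)%N) (oOm : open Om) (bOm : bounded_set Om).
Hypotheses (NG : Nfunction g G) (pp0 : 0 < pp).
Hypothesis gG : forall t, 0 < t -> t * g t <= pp * G t.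
Notation mu := (lebesgue_rV R n).

Let mOm : measurable Om := open_measurable_rV oOm.

(** Exponentials are eigenfunctions of the Laplacian, so a harmonic function of
    W^{2,G}_0 is orthogonal to all of them. *)
Lemma W2G0_harmonic_eq0 u : W2G0 G Om u ->
  {ae mu, forall x, Om x -> laplacian Om u x = 0} ->
  {ae mu, forall x, Om x -> u x = 0}.
Proof.
move=> W0u lap0; have [Wu _] := W0u.
have iu := orlicz_integrable oOm bOm NG (W2G_orlicz oOm NG Wu).
have [M _ OM] := bounded_cube bOm.
have iM f psi : mu.-integrable Om (EFin \o f) -> continuous psi ->
    mu.-integrable Om (EFin \o (fun x => f x * psi x)).
  move=> fi cpsi; have [C _ HC] := continuous_bounded M cpsi.
  apply: (integrable_mul_bounded (C := C)) => //; first exact: continuous_measurable_rV.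
  by move=> x /OM; exact: HC.
have ce xi := smooth_continuous (@smooth_expdot R n xi).
have pp2 xi i : partial i (partial i (expdot xi)) =
    fun x => xi ord0 i ^+ 2 * expdot xi x :> R.
  rewrite partial_expdot.
  rewrite (_ : (fun x => _) = fun x => 0 + xi ord0 i * expdot xi x); last first.
    by apply/funext => x; rewrite add0r.
  rewrite partial_lin; [|exact: smooth_cst|exact: smooth_expdot].
  by rewrite partial_cst partial_expdot; apply/funext => x; ring.
have orth xi : xi != 0 -> \int[mu]_(x in Om) (u x * expdot xi x) = 0.
  move=> xi0; set I := RHS; set J := LHS; rewrite /I.
  have [_ S] := @Rintegral_sum _ _ _ mu Om _ (index_enum 'I_n)
    (fun i x => weakD Om (pure2 i) u x * expdot xi x) mOm
    (fun i => iM _ _ (orlicz_integrable oOm bOm NG (W2G_pure2 oOm NG i Wu).2) (ce xi)).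
  have L0 : \int[mu]_(x in Om) (laplacian Om u x * expdot xi x) = 0.
    have olap := laplacian_orlicz oOm NG pp0 gG Wu.
    have ilap := orlicz_integrable oOm bOm NG olap.
    rewrite (@ae_Rintegral _ _ _ mu Om _ (fun=> 0))//.
    - by rewrite Rintegral_cst// mul0r.
    - by have /integrableP[/measurable_EFinP] := iM _ _ ilap (ce xi).
    - by apply: filterS lap0 => x lx Ox; rewrite lx// mul0r.
  have : (\sum_(i < n) xi ord0 i ^+ 2) * J = 0.
    transitivity (\int[mu]_(x in Om) (laplacian Om u x * expdot xi x)) => //.
    under [RHS]eq_Rintegral do rewrite laplacianE mulr_suml.
    rewrite S mulr_suml; apply: eq_bigr => i _.
    rewrite (W2G0_ibp oOm bOm NG i W0u (@smooth_expdot R n xi)) pp2.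
    rewrite -RintegralZl//; last exact: iM.
    by apply: eq_Rintegral => x _; ring.
  move/eqP; rewrite mulf_eq0 => /orP[|/eqP//].
  rewrite psumr_eq0 => [/allP h|i _]; last exact: sqr_ge0.
  exfalso; move/negP: xi0; apply; apply/eqP/rowP => i; rewrite mxE.
  by have := h i (mem_index_enum i); rewrite sqrf_eq0 => /eqP.
(* the weight exp(x_1 + ... + x_n) keeps the exponents away from 0, where
   harmonicity gives no information *)
have : {ae mu, forall x, Om x -> u x * expdot (const_mx 1) x = 0}.
  apply: ae_eq0_exponentials => //; first exact: iM.
  move=> xi xi0; rewrite -[RHS](orth (const_mx 1 + xi)).
    by apply: eq_Rintegral => x _; rewrite expdotD mulrA.
  apply/eqP => /rowP /(_ (Ordinal n_gt0)); rewrite !mxE => /eqP.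
  by rewrite gt_eqF// ltr_pwDl.
apply: filterS => x hx Ox; have /eqP := hx Ox; rewrite mulf_eq0 => /orP[/eqP//|].
by rewrite gt_eqF// expR_gt0.
Qed.

End uniqueness.

(** * The first variation *)

Section first_variation.
Variables (R : realType) (n : nat) (Om : set 'rV[R]_n) (g G : R -> R) (pp : R).
Hypotheses (oOm : open Om) (NG : Nfunction g G) (pp0 : 0 < pp).
Hypothesis gG : forall t, 0 < t -> t * g t <= pp * G t.
Implicit Types u v w f h : 'rV[R]_n -> R.
Notation mu := (lebesgue_rV R n).
Notation E f := (\int[mu]_(x in Om) G (f x)).

Let mOm : measurable Om := open_measurable_rV oOm.

Lemma orlicz_norm f : orlicz G Om f -> orlicz G Om (fun x => `|f x|).
Proof.
move=> [mf Gf]; split; first exact: measurableT_comp.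
rewrite (_ : modular G Om _ = modular G Om f)//.
by apply: eq_integral => x _; rewrite (Nfun_G_norm NG).
Qed.

Let gM_bound a b : `|g a * b| <= G (`|a| + 1 * `|b|).
Proof.
rewrite normrM (Nfun_g_norm NG) mul1r.
have := Nfun_tangent NG `|a| (`|a| + `|b|); rewrite addrAC subrr add0r.
by have := Nfun_G_ge0 NG `|a|; lra.
Qed.

Lemma integrable_gM f h : orlicz G Om f -> orlicz G Om h ->
  mu.-integrable Om (EFin \o (fun x => g (f x) * h x)).
Proof.
move=> of_ oh; have [mf _] := of_; have [mh _] := oh.
have /(orliczP _ NG)[_ i] :=
  orlicz_lin oOm NG pp0 gG 1 (orlicz_norm of_) (orlicz_norm oh).
apply: (@le_integrable_norm _ _ _ _ _ _ (fun x => G (`|f x| + 1 * `|h x|))) => //.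
by apply: measurable_funM => //; exact: measurable_Nfung NG _ mf.
Qed.

Lemma energy_tangent f h (t : R) : orlicz G Om f -> orlicz G Om h ->
  E f + t * \int[mu]_(x in Om) (g (f x) * h x) <= E (fun x => f x + t * h x).
Proof.
move=> of_ oh; have [_ iF] := (orliczP _ NG _).1 of_.
have [_ iS] := (orliczP _ NG _).1 (orlicz_lin oOm NG pp0 gG t of_ oh).
have ig := integrable_gM of_ oh.
rewrite -Rintegral_lin//; apply: le_Rintegral => //; first exact: integrable_lin.
by move=> x _; have := Nfun_tangent NG (f x) (f x + t * h x); lra.
Qed.

(** One-sided first-order condition: the difference quotients of the energy are
    at most the integral of g(f + t h) h, whose limit is found by dominated
    convergence. *)
Lemma energy_min_variation f h : orlicz G Om f -> orlicz G Om h ->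
  (forall t : R, E f <= E (fun x => f x + t * h x)) ->
  0 <= \int[mu]_(x in Om) (g (f x) * h x).
Proof.
move=> of_ oh min.
have ot t := orlicz_lin oOm NG pp0 gG t of_ oh.
have pos k : 0 <= \int[mu]_(x in Om) (g (f x + k.+1%:R^-1 * h x) * h x).
  have t0 : 0 < k.+1%:R^-1 :> R by rewrite invr_gt0.
  have := energy_tangent (- k.+1%:R^-1) (ot k.+1%:R^-1) oh.
  rewrite (_ : E (fun x => f x + _ * h x + - _ * h x) = E f); last first.
    by apply: eq_Rintegral => x _; congr G; ring.
  move=> le; have := le_trans le (min k.+1%:R^-1).
  by rewrite mulNr gerDl oppr_le0 pmulr_rge0.
have [mf _] := of_; have [mh _] := oh.
suff H : \int[mu]_(x in Om) (g (f x + k.+1%:R^-1 * h x) * h x) @[k --> \oo] -->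
    \int[mu]_(x in Om) (g (f x) * h x).
  rewrite -(cvg_lim (@Rhausdorff R) H); apply: limr_ge.
    by apply/cvg_ex; eexists; exact: H.
  exact: nearW.
apply: (@Rdominated_cvg _ _ _ _ _ _ _ (fun x => g (`|f x| + 1 * `|h x|) * `|h x|)) => //.
- move=> k; apply: measurable_funM => //; apply: measurable_Nfung NG _ _.
  by apply: measurable_funD => //; exact: measurable_funM.
- by apply: measurable_funM => //; exact: measurable_Nfung NG _ mf.
- move=> x Ox; apply: cvgM; last exact: cvg_cst.
  have lim : f x + k.+1%:R^-1 * h x @[k --> \oo] --> f x.
    rewrite -[X in _ --> X]addr0; apply: cvgD; first exact: cvg_cst.
    by rewrite -[X in _ --> X](mul0r (h x)); apply: cvgMl; exact: cvg_harmonic.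
  have gc : continuous g by exact: Nfun_g_continuous NG.
  exact: (continuous_cvg _ (gc (f x)) lim).
- apply: integrable_gM; last exact: orlicz_norm.
  by apply: (orlicz_lin oOm NG pp0 gG); exact: orlicz_norm.
- move=> k x Ox; rewrite normrM ler_wpM2r// (Nfun_g_norm NG).
  apply: (Nfun_g_nondecreasing NG); rewrite mul1r (le_trans (ler_normD _ _))//.
  by rewrite lerD2l normrM ler_piMl// ger0_norm ?invr_ge0// invf_le1// ler1n.
Qed.

(** Along the ray s f the energy is continuous (indeed Lipschitz) and vanishes at
    the origin, so it takes every value below E f. *)
Lemma energy_rescale f (r : R) : orlicz G Om f -> 0 <= r -> r <= E f ->
  exists2 s, 0 <= s <= 1 & E (fun x => s * f x) = r.
Proof.
move=> of_ r0 rE.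
have oabs := orlicz_norm of_.
have ig := integrable_gM oabs oabs.
pose L := \int[mu]_(x in Om) (g `|f x| * `|f x|).
have L0 : 0 <= L.
  by apply: Rintegral_ge0 => x _; rewrite mulr_ge0// (Nfun_g_ge0 NG).
have os s : orlicz G Om (fun x => s * f x).
  have := orlicz_lin oOm NG pp0 gG s (orlicz0 Om NG) of_.
  by congr (orlicz G Om _); apply/funext => x; rewrite add0r.
have iG s := ((orliczP _ NG _).1 (os s)).2.
have lip s s' : 0 <= s <= 1 -> E (fun x => s * f x) - E (fun x => s' * f x) <= `|s - s'| * L.
  move=> /andP[s0 s1]; rewrite -RintegralB//.
  rewrite -RintegralZl//; apply: le_Rintegral => //.
  - by apply: (integrableB mOm (iG s) (iG s')).
  - exact: integrable_scale.
  move=> x _; have := Nfun_tangent NG (s * f x) (s' * f x).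
  suff : g (s * f x) * (s * f x - s' * f x) <= `|s - s'| * (g `|f x| * `|f x|) by lra.
  apply: le_trans (ler_norm _) _; rewrite -mulrBl !normrM (Nfun_g_norm NG) mulrCA.
  rewrite ler_wpM2l// ler_wpM2r//; apply: (Nfun_g_nondecreasing NG).
  by rewrite normrM ler_piMl// ger0_norm.
pose psi s := E (fun x => s * f x).
have cpsi : {within `[0, 1], continuous psi}.
  apply/subspace_continuousP => s; rewrite /= in_itv/= => s01.
  apply/cvgrPdist_le => /= e e0.
  have d0 : 0 < e / (L + 1) by rewrite divr_gt0// ltr_wpDl.
  rewrite near_withinE; near=> t => /= t01.
  have {}t01 : 0 <= t <= 1 by move: t01; rewrite ?in_itv.
  have st : `|s - t| <= e / (L + 1).
    by near: t; apply: cvgr_dist_le => //; exact: cvg_id.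
  have stL : `|s - t| * L <= e.
    apply: (@le_trans _ _ (`|s - t| * (L + 1))).
      by rewrite ler_wpM2l// lerDl.
    by rewrite -ler_pdivlMr// ltr_wpDl.
  have h1 : psi s - psi t <= e by apply: le_trans (lip s t s01) _.
  have h2 : psi t - psi s <= e by rewrite (le_trans (lip t s t01))// distrC.
  by rewrite ler_norml h1 andbT lerNl opprB.
have [|s] := @IVT R psi 0 1 r ler01 cpsi.
  have -> : psi 0 = 0.
    rewrite /psi (_ : (\int[mu]_(x in Om) G (0 * f x)) = \int[mu]_(x in Om) 0).
      by rewrite Rintegral_cst// mul0r.
    by apply: eq_Rintegral => x _; rewrite mul0r (NfunG0 NG).
  have -> : psi 1 = E f by apply: eq_Rintegral => x _; rewrite mul1r.
  by rewrite min_l ?max_r ?(le_trans r0 rE)// r0 rE.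
by rewrite in_itv/= => s01 sr; exists s.
Unshelve. all: by end_near. Qed.

Lemma Nfun_le_gM t : G t <= g t * t.
Proof. by have := Nfun_tangent NG t 0; rewrite (NfunG0 NG); lra. Qed.

Lemma energy_le_pairing f : orlicz G Om f -> E f <= \int[mu]_(x in Om) (g (f x) * f x).
Proof.
move=> of_; have [_ iF] := (orliczP _ NG _).1 of_.
apply: le_Rintegral => //; first exact: integrable_gM.
by move=> x _; exact: Nfun_le_gM.
Qed.

Lemma energy_eq0 f : orlicz G Om f -> E f <= 0 -> {ae mu, forall x, Om x -> f x = 0}.
Proof.
move=> of_ E0; have [mf iF] := (orliczP _ NG _).1 of_.
have : (\int[mu]_(x in Om) `|(G (f x))%:E| = 0)%E.
  under eq_integral do rewrite gee0_abs ?lee_fin ?(Nfun_G_ge0 NG)//.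
  have E0' : E f = 0.
    by apply/eqP; rewrite eq_le E0/= Rintegral_ge0// => x _; exact: (Nfun_G_ge0 NG).
  by rewrite -[LHS]fineK ?integrable_fin_num//; congr EFin; exact: E0'.
move=> /(ae_eq_integral_abs _ mOm _).1 h.
have : ae_eq mu Om (fun x => (G (f x))%:E) (cst 0%E).
  by apply: h; apply/measurable_EFinP; exact: measurable_NfunG NG _ mf.
apply: filterS => x hx Ox; have := hx Ox => -[] /eqP; apply: contraTeq => fx.
by rewrite gt_eqF// (Nfun_G_gt0 NG).
Qed.

End first_variation.

(** * The Lagrange multiplier *)

Section minimizer.
Variables (R : realType) (n : nat) (Om : set 'rV[R]_n) (g G : R -> R) (pp r : R).
Hypotheses (oOm : open Om) (bOm : bounded_set Om) (NG : Nfunction g G).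
Hypotheses (pp0 : 0 < pp) (gG : forall t, 0 < t -> t * g t <= pp * G t).
Hypothesis r0 : 0 < r.
Notation mu := (lebesgue_rV R n).
Notation lap := (laplacian Om).
Notation E f := (\int[mu]_(x in Om) G (f x)).
Variable u : 'rV[R]_n -> R.
Hypotheses (W0u : W2G0 G Om u) (ur : modular G Om u = r%:E).
Hypothesis u_min : modular G Om (lap u) = min_energy G Om r.
Implicit Types v w : 'rV[R]_n -> R.

Let mOm : measurable Om := open_measurable_rV oOm.
Let W2G0_o v : W2G0 G Om v -> orlicz G Om v.
Proof. by move=> [Wv _]; exact: (W2G_orlicz oOm NG). Qed.
Let W2G0_lap v : W2G0 G Om v -> orlicz G Om (lap v).
Proof. by move=> [Wv _]; exact: (laplacian_orlicz oOm NG pp0 gG). Qed.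
Let mo f : orlicz G Om f -> measurable_fun Om f. Proof. by case. Qed.

Lemma minimizer_constraint : E u = r.
Proof.
by have := ur; rewrite (modularE oOm NG (W2G0_o W0u)) => -[].
Qed.

(** Tangential directions do not decrease the energy. By convexity the
    constraint does not decrease along u + t w, so u + t w is brought back to the
    constraint by a factor s in [0, 1], which does not increase the energy. *)
Lemma minimizer_tangential w (t : R) : W2G0 G Om w ->
  \int[mu]_(x in Om) (g (u x) * w x) = 0 ->
  E (lap u) <= E (fun x => lap u x + t * lap w x).
Proof.
move=> W0w bw; pose z x := u x + t * w x.
have W0z : W2G0 G Om z by exact: (W2G0_lin oOm NG pp0 gG).
have rz : r <= E z.
  have := energy_tangent oOm NG pp0 gG t (W2G0_o W0u) (W2G0_o W0w).
  by rewrite bw mulr0 addr0 minimizer_constraint.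
have [s s01 sr] := energy_rescale oOm NG pp0 gG (W2G0_o W0z) (ltW r0) rz.
pose y x := z x + (s - 1) * z x.
have W0y : W2G0 G Om y by exact: (W2G0_lin oOm NG pp0 gG).
have yE : y = fun x => s * z x by apply/funext => x; rewrite /y; ring.
have yr : modular G Om y = r%:E.
  by rewrite (modularE oOm NG (W2G0_o W0y)) yE sr.
have : (modular G Om (lap u) <= modular G Om (lap y))%E.
  by rewrite u_min; apply: ge_ereal_inf; exists (modular G Om (lap y)) => //; exists y.
rewrite !(modularE oOm NG)//; [|exact: W2G0_lap..]; rewrite lee_fin => /le_trans; apply.
have lapz := laplacian_lin oOm NG t W0u.1 W0w.1.
have lapy := laplacian_lin oOm NG (s - 1) W0z.1 W0z.1.
have ow := orlicz_lin oOm NG pp0 gG t (W2G0_lap W0u) (W2G0_lap W0w).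
rewrite (_ : E (fun x => lap u x + t * lap w x) = E (lap z)); last first.
  apply: ae_Rintegral => //; try by apply: (measurable_NfunG NG); apply: mo => //; exact: W2G0_lap.
  by apply: filterS lapz => x h Ox; rewrite -(h Ox).
have osz := orlicz_lin oOm NG pp0 gG (s - 1) (W2G0_lap W0z) (W2G0_lap W0z).
rewrite (_ : E (lap y) = E (fun x => lap z x + (s - 1) * lap z x)); last first.
  apply: ae_Rintegral => //; try by apply: (measurable_NfunG NG); apply: mo => //; exact: W2G0_lap.
  by apply: filterS lapy => x h Ox; rewrite -(h Ox).
have [_ i1] := (orliczP _ NG _).1 osz.
have [_ i2] := (orliczP _ NG _).1 (W2G0_lap W0z).
apply: le_Rintegral => // x _; apply: (Nfun_G_le NG).
have -> : lap z x + (s - 1) * lap z x = s * lap z x by ring.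
by have /andP[s0 s1] := s01; rewrite normrM ler_piMl// ger0_norm.
Qed.

(** The one-sided conditions for w and for - w = w - 2 w combine. *)
Lemma minimizer_orthogonal w : W2G0 G Om w ->
  \int[mu]_(x in Om) (g (u x) * w x) = 0 ->
  \int[mu]_(x in Om) (g (lap u x) * lap w x) = 0.
Proof.
move=> W0w bw.
have half v : W2G0 G Om v -> \int[mu]_(x in Om) (g (u x) * v x) = 0 ->
    0 <= \int[mu]_(x in Om) (g (lap u x) * lap v x).
  move=> W0v bv; apply: (energy_min_variation oOm NG pp0 gG); [exact: W2G0_lap..|].
  by move=> t; exact: minimizer_tangential.
pose w' x := w x + (-2) * w x.
have W0w' : W2G0 G Om w' by exact: (W2G0_lin oOm NG pp0 gG).
have lw' := laplacian_lin oOm NG (-2) W0w.1 W0w.1.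
have ow := W2G0_lap W0w; have olu := W2G0_lap W0u.
have ig := integrable_gM oOm NG pp0 gG olu ow.
have igw := integrable_gM oOm NG pp0 gG (W2G0_o W0u) (W2G0_o W0w).
have bw' : \int[mu]_(x in Om) (g (u x) * w' x) = 0.
  rewrite (_ : \int[mu]_(x in Om) (g (u x) * w' x) =
    \int[mu]_(x in Om) (g (u x) * w x + (-2) * (g (u x) * w x))).
    by rewrite Rintegral_lin// bw mulr0 addr0.
  by apply: eq_Rintegral => x _; rewrite /w'; ring.
have := half _ W0w bw; have := half _ W0w' bw'.
rewrite (_ : \int[mu]_(x in Om) (g (lap u x) * lap w' x) =
  \int[mu]_(x in Om) (g (lap u x) * lap w x + (-2) * (g (lap u x) * lap w x))).
  by rewrite Rintegral_lin//; lra.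
apply: ae_Rintegral => //.
- have igw' := integrable_gM oOm NG pp0 gG olu (W2G0_lap W0w').
  by have /integrableP[/measurable_EFinP] := igw'.
- by have /integrableP[/measurable_EFinP] := integrable_lin (-2) mOm ig ig.
- by apply: filterS lw' => x h Ox; rewrite (h Ox); ring.
Qed.

(** Every v becomes tangential to the constraint after subtracting a multiple of
    u; the multiple determines the multiplier. *)
Lemma minimizer_Euler_Lagrange v : W2G0 G Om v ->
  \int[mu]_(x in Om) (g (lap u x) * lap v x) =
  (\int[mu]_(x in Om) (g (lap u x) * lap u x)) /
  (\int[mu]_(x in Om) (g (u x) * u x)) *
  \int[mu]_(x in Om) (g (u x) * v x).
Proof.
move=> W0v; set A := \int[mu]_(x in Om) (g (lap u x) * lap u x).
set B := \int[mu]_(x in Om) (g (u x) * u x).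
have B0 : 0 < B.
  apply: lt_le_trans (energy_le_pairing oOm NG pp0 gG (W2G0_o W0u)).
  by rewrite minimizer_constraint.
set bv := \int[mu]_(x in Om) (g (u x) * v x).
pose k := - (bv / B); pose w x := v x + k * u x.
have W0w : W2G0 G Om w by exact: (W2G0_lin oOm NG pp0 gG).
have olu := W2G0_lap W0u; have olv := W2G0_lap W0v.
have iuv := integrable_gM oOm NG pp0 gG (W2G0_o W0u) (W2G0_o W0v).
have iuu := integrable_gM oOm NG pp0 gG (W2G0_o W0u) (W2G0_o W0u).
have ilv := integrable_gM oOm NG pp0 gG olu olv.
have ilu := integrable_gM oOm NG pp0 gG olu olu.
have bw : \int[mu]_(x in Om) (g (u x) * w x) = 0.
  rewrite (_ : \int[mu]_(x in Om) (g (u x) * w x) =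
    \int[mu]_(x in Om) (g (u x) * v x + k * (g (u x) * u x))).
    by rewrite Rintegral_lin// -/bv -/B /k mulNr divfK ?gt_eqF// subrr.
  by apply: eq_Rintegral => x _; rewrite /w; ring.
have := minimizer_orthogonal W0w bw.
rewrite (_ : \int[mu]_(x in Om) (g (lap u x) * lap w x) =
    \int[mu]_(x in Om) (g (lap u x) * lap v x + k * (g (lap u x) * lap u x))).
  rewrite Rintegral_lin// -/A => /eqP; rewrite addr_eq0 => /eqP ->.
  by rewrite /k; ring.
apply: ae_Rintegral => //.
- have ilw := integrable_gM oOm NG pp0 gG olu (W2G0_lap W0w).
  by have /integrableP[/measurable_EFinP] := ilw.
- by have /integrableP[/measurable_EFinP] := integrable_lin k mOm ilv ilu.
- apply: filterS (laplacian_lin oOm NG k W0v.1 W0u.1) => x h Ox.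
  by rewrite (h Ox); ring.
Qed.

(** The numerator dominates the energy, which vanishes only if the Laplacian of u
    does; then u = 0, contrary to the constraint. *)
Lemma minimizer_multiplier_gt0 : (0 < n)%N ->
  0 < (\int[mu]_(x in Om) (g (lap u x) * lap u x)) /
      (\int[mu]_(x in Om) (g (u x) * u x)).
Proof.
move=> n_gt0; have olu := W2G0_lap W0u.
apply: divr_gt0; last first.
  apply: lt_le_trans (energy_le_pairing oOm NG pp0 gG (W2G0_o W0u)).
  by rewrite minimizer_constraint.
apply: lt_le_trans (energy_le_pairing oOm NG pp0 gG olu).
rewrite ltNge; apply/negP => /(energy_eq0 oOm NG olu).
move=> /(W2G0_harmonic_eq0 n_gt0 oOm bOm NG pp0 gG W0u) u0.
have : E u = 0.
  rewrite (@ae_Rintegral _ _ _ mu Om _ (fun=> 0))//.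
  - by rewrite Rintegral_cst// mul0r.
  - by apply: (measurable_NfunG NG); apply: mo; exact: W2G0_o.
  - by apply: filterS u0 => x ux Ox; rewrite ux// (NfunG0 NG).
by rewrite minimizer_constraint => rE; move: r0; rewrite rE ltxx.
Qed.

End minimizer.

Theorem theorem5p4 (R : realType) (n : nat) (n_gt0 : (0 < n)%N)
    (Om : set 'rV[R]_n) (g G : R -> R) (pm pp r : R) (ur : 'rV[R]_n -> R) :
  open Om -> connected Om -> Om !=set0 -> bounded_set Om ->
  Nfunction g G ->
  (\int[lebesgue_measure]_(s in `]0%R, 1%R])
    (Ninv G s / s `^ (n.+1%:R / n%:R))%:E < +oo)%E ->
  (\int[lebesgue_measure]_(s in `[1%R, +oo[)
    (Ninv G s / s `^ (n.+1%:R / n%:R))%:E = +oo)%E ->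
  1 < pm ->
  (forall t, 0 < t -> pm <= t * g t / G t <= pp) ->
  0 < r ->
  W2G0 G Om ur ->
  modular G Om ur = r%:E ->
  modular G Om (laplacian Om ur) = min_energy G Om r ->
  exists2 lam : R, 0 < lam &
    forall v : 'rV[R]_n -> R, W2G0 G Om v ->
      let lhs x := g `|laplacian Om ur x| / `|laplacian Om ur x|
                   * laplacian Om ur x * laplacian Om v x in
      let rhs x := g `|ur x| / `|ur x| * ur x * v x in
      [/\ (lebesgue_rV R n).-integrable Om (EFin \o lhs),
          (lebesgue_rV R n).-integrable Om (EFin \o rhs) &
          \int[lebesgue_rV R n]_(x in Om) lhs x =
          lam * \int[lebesgue_rV R n]_(x in Om) rhs x].
Proof.
move=> oOm _ _ bOm NG _ _ pm1 pmp r0 W0u Eu u_min.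
have gG t : 0 < t -> t * g t <= pp * G t.
  move=> t0; have /andP[_] := pmp t t0.
  by rewrite ler_pdivrMr// (Nfun_G_gt0 NG)// gt_eqF.
have pp0 : 0 < pp.
  by have /andP[p1 p2] := pmp 1 ltr01; apply: lt_le_trans (le_trans p1 p2); lra.
(* the quotient g(|s|)/|s| * s is the odd function g itself *)
have gE s : g `|s| / `|s| * s = g s.
  have [->|s0] := eqVneq s 0; first by rewrite mulr0 (Nfun_g0 NG).
  rewrite -mulrA mulrC mulrAC; case: (ltrgtP s 0) s0 => // sgn _.
    by rewrite (ltr0_norm sgn) (Nfun_g_odd NG); field; rewrite lt_eqF.
  by rewrite (gtr0_norm sgn); field; rewrite gt_eqF.
exists ((\int[lebesgue_rV R n]_(x in Om) (g (laplacian Om ur x) * laplacian Om ur x)) /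
        (\int[lebesgue_rV R n]_(x in Om) (g (ur x) * ur x))).
  exact: (minimizer_multiplier_gt0 oOm bOm NG pp0 gG r0 W0u Eu).
move=> v W0v lhs rhs.
have -> : lhs = fun x => g (laplacian Om ur x) * laplacian Om v x.
  by apply/funext => x; rewrite /lhs gE.
have -> : rhs = fun x => g (ur x) * v x by apply/funext => x; rewrite /rhs gE.
split.
- by apply: (integrable_gM oOm NG pp0 gG);
    [exact: (laplacian_orlicz oOm NG pp0 gG W0u.1)|
     exact: (laplacian_orlicz oOm NG pp0 gG W0v.1)].
- by apply: (integrable_gM oOm NG pp0 gG);
    [exact: (W2G_orlicz oOm NG W0u.1)|exact: (W2G_orlicz oOm NG W0v.1)].
- exact: (minimizer_Euler_Lagrange oOm NG pp0 gG r0 W0u Eu u_min W0v).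
Qed.
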